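(* Let $M$ be a non-minimal meridian surface of type $\mathcal{M}''$, i.e. $z(u,v)=f(u)\,l(v)+g(u)\,e_4$ with $l$ a unit-speed (necessarily spacelike) curve on $\mathbb{H}^2_1(-1)\subset\mathrm{span}\{e_1,e_2,e_3\}$ (respectively, of type $\widetilde{\mathcal{M}}'$, i.e. $z(u,v)=g(u)\,e_1+f(u)\,l(v)$ with $l$ a unit-speed (necessarily timelike) curve on $\mathbb{S}^2_2(1)\subset\mathrm{span}\{e_2,e_3,e_4\}$), where $f'^2+g'^2=1$ and $g'$ is nowhere zero. Let $\kappa$ be the spherical curvature of $l$. Then $M$ has parallel mean curvature vector field if and only if one of the following cases holds: (i) the curve $l$ has constant spherical curvature $\kappa$ and the meridian is given by $f(u)=a$, $g(u)=\pm u+b$, where $a\neq0$ and $b$ are real constants. In this case $M$ is a flat CMC-surface. (ii) the curve $l$ has zero spherical curvature ($\kappa\equiv0$) and the meridian is determined by $f'=\varphi(f)$, where $$\varphi(t)=\pm\frac{1}{t}\sqrt{t^2-(c\pm a\,t^2)^2},\qquad a=\mathrm{const}\neq0,\quad c=\mathrm{const},$$ and $g$ is determined, up to replacing $g$ by $-g$, by $g'=\sqrt{1-f'^2}$. In this case $M$ lies in a hyperplane of $\mathbb{E}^4_2$.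
   Context: Ambient space: $\mathbb{E}^4_2$ is $\mathbb{R}^4$ with the metric $\langle\cdot,\cdot\rangle=dx_1^2+dx_2^2-dx_3^2-dx_4^2$; $e_1,e_2,e_3,e_4$ is the standard basis, so $\langle e_1,e_1\rangle=\langle e_2,e_2\rangle=1$, $\langle e_3,e_3\rangle=\langle e_4,e_4\rangle=-1$. A vector $v$ is spacelike if $\langle v,v\rangle>0$ or $v=0$, timelike if $\langle v,v\rangle<0$. Meridian surfaces: $f,g$ are smooth real functions on an open interval $I$, $f$ nowhere zero; $l$ is a smooth curve on an open interval $J$; $u\in I$, $v\in J$. The curve $u\mapsto(f(u),g(u))$ is called the meridian. The standing assumption that $g'$ is nowhere zero is equivalent here to $f'^2<1$. Type $\mathcal{M}''$: $z(u,v)=f(u)l(v)+g(u)e_4$, where $l(v)=\sinh w^1\cos w^2\,e_1+\sinh w^1\sin w^2\,e_2+\cosh w^1\,e_3$ with $w^1=w^1(v)$, $w^2=w^2(v)$ smooth, a curve on $\mathbb{H}^2_1(-1)=\{V\in\mathrm{span}\{e_1,e_2,e_3\}:\langle V,V\rangle=-1\}$ with $\langle l',l'\rangle=1$, and $f'^2+g'^2=1$. The first fundamental form is $E=-1$, $F=0$, $G=f^2$. Type $\widetilde{\mathcal{M}}'$: $z(u,v)=g(u)e_1+f(u)l(v)$, where $l(v)=\cosh w^1\,e_2+\sinh w^1\cos w^2\,e_3+\sinh w^1\sin w^2\,e_4$ with $w^1,w^2$ smooth functions of $v$, a curve on $\mathbb{S}^2_2(1)=\{V\in\mathrm{span}\{e_2,e_3,e_4\}:\langle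 V,V\rangle=1\}$ with $\langle l',l'\rangle=-1$, and $f'^2+g'^2=1$. The first fundamental form is $E=1$, $F=0$, $G=-f^2$. (This surface is the image of a surface of type $\mathcal{M}''$ under the linear map $T(x_1,x_2,x_3,x_4)=(x_4,x_3,x_1,x_2)$, which reverses the sign of the metric.) Both are Lorentz surfaces (induced metric of signature $(1,1)$). Spherical curvature: let $t=l'$ and let $n(v)$ be the smooth vector field, unique up to sign, in the 3-dimensional space containing $l$, such that $\{l,t,n\}$ is an orthonormal frame (so $\langle n,n\rangle=\pm1$). Then $\kappa(v)=\langle t'(v),n(v)\rangle$ (its overall sign depends on the choice of $n$ and is immaterial here). Mean curvature: $h$ is the second fundamental form, $H=\tfrac12\,\mathrm{tr}\,h$ (trace with respect to the induced metric) is the mean curvature vector field, $D$ is the normal connection. The surface is minimal if $H\equiv0$; it has parallel mean curvature vector field if $DH=0$ identically. ''CMC'' means that $\langle H,H\rangle$ is constant (possibly zero); ''flat'' means that the Gauss curvature vanishes identically. Convention on signs: the relation $f'=\varphi(f)$ with $\varphi=\pm\cdots$ means $f'(u)^2=\varphi(f(u))^2$ on $I$ (the outer sign may change where $f'$ vanishes); the inner sign $\pm a$ is fixed. *)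

(* Defs.v *)
(* Real numbers of Stdlib with Coquelicot's derivatives and module structure. *)
From Stdlib Require Import Reals.
From Coquelicot Require Import Coquelicot.
Open Scope R_scope.

(* As a product, R^4 carries Coquelicot's [plus], [opp], [scal] and [zero]. *)
Notation E42 := (R * R * R * R)%type.

Definition x1 (p : E42) : R := fst (fst (fst p)).
Definition x2 (p : E42) : R := snd (fst (fst p)).
Definition x3 (p : E42) : R := snd (fst p).
Definition x4 (p : E42) : R := snd p.

Definition e1 : E42 := (1, 0, 0, 0).
Definition e4 : E42 := (0, 0, 0, 1).

Definition inner (p q : E42) : R :=
  x1 p * x1 q + x2 p * x2 q - x3 p * x3 q - x4 p * x4 q.

Definition open_interval (I : R -> Prop) : Prop :=
  exists a b : Rbar, Rbar_lt a b /\
    forall x : R, I x <-> (Rbar_lt a x /\ Rbar_lt x b).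

Definition smooth_on (I : R -> Prop) (f : R -> R) : Prop :=
  forall (k : nat) (x : R), I x -> ex_derive_n f k x.

Definition vsmooth_on (I : R -> Prop) (p : R -> E42) : Prop :=
  smooth_on I (fun s => x1 (p s)) /\ smooth_on I (fun s => x2 (p s)) /\
  smooth_on I (fun s => x3 (p s)) /\ smooth_on I (fun s => x4 (p s)).

Definition vDerive (p : R -> E42) (s : R) : E42 :=
  (Derive (fun r => x1 (p r)) s, Derive (fun r => x2 (p r)) s,
   Derive (fun r => x3 (p r)) s, Derive (fun r => x4 (p r)) s).

Definition Du (X : R -> R -> E42) (u v : R) : E42 := vDerive (fun s => X s v) u.
Definition Dv (X : R -> R -> E42) (u v : R) : E42 := vDerive (fun s => X u s) v.

Definition fffE (z : R -> R -> E42) (u v : R) : R := inner (Du z u v) (Du z u v).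
Definition fffF (z : R -> R -> E42) (u v : R) : R := inner (Du z u v) (Dv z u v).
Definition fffG (z : R -> R -> E42) (u v : R) : R := inner (Dv z u v) (Dv z u v).
Definition fffdet (z : R -> R -> E42) (u v : R) : R :=
  fffE z u v * fffG z u v - fffF z u v ^ 2.

(* Orthogonal projection of [w] to the tangent plane spanned by z_u and z_v:
   its coefficients solve the Gram system with matrix (E F; F G). *)
Definition tangent_part (z : R -> R -> E42) (u v : R) (w : E42) : E42 :=
  let wu := inner w (Du z u v) in
  let wv := inner w (Dv z u v) in
  plus
    (scal ((fffG z u v * wu - fffF z u v * wv) / fffdet z u v) (Du z u v))
    (scal ((fffE z u v * wv - fffF z u v * wu) / fffdet z u v) (Dv z u v)).

Definition normal_part (z : R -> R -> E42) (u v : R) (w : E42) : E42 :=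
  minus w (tangent_part z u v w).

Definition huu (z : R -> R -> E42) (u v : R) : E42 :=
  normal_part z u v (Du (Du z) u v).
Definition huv (z : R -> R -> E42) (u v : R) : E42 :=
  normal_part z u v (Du (Dv z) u v).
Definition hvv (z : R -> R -> E42) (u v : R) : E42 :=
  normal_part z u v (Dv (Dv z) u v).

(* The inverse of the metric matrix (E F; F G) is (G -F; -F E) / (E G - F^2). *)
Definition trace_h (z : R -> R -> E42) (u v : R) : E42 :=
  plus (scal (fffG z u v / fffdet z u v) (huu z u v))
    (plus (scal (- 2 * fffF z u v / fffdet z u v) (huv z u v))
          (scal (fffE z u v / fffdet z u v) (hvv z u v))).

Definition mean_curvature (z : R -> R -> E42) (u v : R) : E42 :=
  scal (1 / 2) (trace_h z u v).

(* Covariant derivatives of the induced Levi-Civita connection along the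
   coordinate fields, for tangent fields [X]. *)
Definition nabla_u (z X : R -> R -> E42) (u v : R) : E42 :=
  tangent_part z u v (Du X u v).
Definition nabla_v (z X : R -> R -> E42) (u v : R) : E42 :=
  tangent_part z u v (Dv X u v).

(* K = <R(z_u,z_v)z_v, z_u> / (E G - F^2); the bracket term of the curvature
   tensor vanishes because the coordinate fields commute. *)
Definition gauss_curvature (z : R -> R -> E42) (u v : R) : R :=
  inner (minus (nabla_u z (nabla_v z (Dv z)) u v)
               (nabla_v z (nabla_u z (Dv z)) u v)) (Du z u v)
  / fffdet z u v.

(* Covariant derivatives of the normal connection, for normal fields [xi]. *)
Definition normal_D_u (z xi : R -> R -> E42) (u v : R) : E42 :=
  normal_part z u v (Du xi u v).
Definition normal_D_v (z xi : R -> R -> E42) (u v : R) : E42 :=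
  normal_part z u v (Dv xi u v).

Definition minimal (I J : R -> Prop) (z : R -> R -> E42) : Prop :=
  forall u v, I u -> J v -> mean_curvature z u v = zero.

Definition parallel_mean_curvature (I J : R -> Prop) (z : R -> R -> E42) : Prop :=
  forall u v, I u -> J v ->
    normal_D_u z (mean_curvature z) u v = zero /\
    normal_D_v z (mean_curvature z) u v = zero.

Definition CMC (I J : R -> Prop) (z : R -> R -> E42) : Prop :=
  exists c : R, forall u v, I u -> J v ->
    inner (mean_curvature z u v) (mean_curvature z u v) = c.

Definition flat (I J : R -> Prop) (z : R -> R -> E42) : Prop :=
  forall u v, I u -> J v -> gauss_curvature z u v = 0.

(* As [inner] is nondegenerate, every affine hyperplane is {p | <N,p> = d}
   for some N <> 0 and d. *)
Definition lies_in_hyperplane (I J : R -> Prop) (z : R -> R -> E42) : Prop :=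
  exists (N : E42) (d : R), N <> zero /\
    forall u v, I u -> J v -> inner N (z u v) = d.

(* [M_pp] is the type M'' (curve on H^2_1(-1)), [Mt_p] is the type
   M-tilde' (curve on S^2_2(1)). *)
Inductive meridian_type : Set := M_pp | Mt_p.

Definition directrix (ty : meridian_type) (w1 w2 : R -> R) (v : R) : E42 :=
  match ty with
  | M_pp => (sinh (w1 v) * cos (w2 v), sinh (w1 v) * sin (w2 v), cosh (w1 v), 0)
  | Mt_p => (0, cosh (w1 v), sinh (w1 v) * cos (w2 v), sinh (w1 v) * sin (w2 v))
  end.

Definition speed_sign (ty : meridian_type) : R :=
  match ty with M_pp => 1 | Mt_p => -1 end.

Definition in_span3 (ty : meridian_type) (p : E42) : Prop :=
  match ty with M_pp => x4 p = 0 | Mt_p => x1 p = 0 end.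

Definition position (ty : meridian_type) (f g : R -> R) (l : R -> E42)
    (u v : R) : E42 :=
  match ty with
  | M_pp => plus (scal (f u) (l v)) (scal (g u) e4)
  | Mt_p => plus (scal (g u) e1) (scal (f u) (l v))
  end.

Record meridian_surface (ty : meridian_type) (I J : R -> Prop)
    (f g w1 w2 : R -> R) : Prop := {
  ms_interval_I : open_interval I;
  ms_interval_J : open_interval J;
  ms_smooth_f : smooth_on I f;
  ms_smooth_g : smooth_on I g;
  ms_smooth_w1 : smooth_on J w1;
  ms_smooth_w2 : smooth_on J w2;
  ms_f_neq0 : forall u, I u -> f u <> 0;
  ms_dg_neq0 : forall u, I u -> Derive g u <> 0;
  ms_unit_meridian : forall u, I u -> Derive f u ^ 2 + Derive g u ^ 2 = 1;
  ms_unit_directrix : forall v, J v ->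
    inner (vDerive (directrix ty w1 w2) v) (vDerive (directrix ty w1 w2) v)
    = speed_sign ty
}.

(* [n] completes l, l' to an orthonormal frame of the 3-space containing l. *)
Definition frame_normal (ty : meridian_type) (J : R -> Prop)
    (l n : R -> E42) : Prop :=
  vsmooth_on J n /\
  forall v, J v ->
    in_span3 ty (n v) /\ inner (n v) (l v) = 0 /\
    inner (n v) (vDerive l v) = 0 /\
    (inner (n v) (n v) = 1 \/ inner (n v) (n v) = -1).

Definition spherical_curvature (l n : R -> E42) (v : R) : R :=
  inner (vDerive (vDerive l) v) (n v).

Definition is_sign (s : R) : Prop := s = 1 \/ s = -1.

Definition case_i (I J : R -> Prop) (f g kappa : R -> R) : Prop :=
  (exists k : R, forall v, J v -> kappa v = k) /\
  exists a b s : R, a <> 0 /\ is_sign s /\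
    forall u, I u -> f u = a /\ g u = s * u + b.

Definition radicand (a c s t : R) : R := t ^ 2 - (c + s * a * t ^ 2) ^ 2.

Definition phi (a c s t : R) : R := 1 / t * sqrt (radicand a c s t).

(* The inner sign [s] is fixed. The outer sign may change where f' vanishes,
   so the equation is on squares; [sqrt] being total, the radicand is
   required to be nonnegative along f. *)
Definition case_ii (I J : R -> Prop) (f g kappa : R -> R) : Prop :=
  (forall v, J v -> kappa v = 0) /\
  (exists a c s : R, a <> 0 /\ is_sign s /\
    forall u, I u ->
      0 <= radicand a c s (f u) /\ Derive f u ^ 2 = phi a c s (f u) ^ 2) /\
  ((forall u, I u -> Derive g u = sqrt (1 - Derive f u ^ 2)) \/
   (forall u, I u -> Derive g u = - sqrt (1 - Derive f u ^ 2))).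

(* Main.v *)
Require Import Defs.
From Stdlib Require Import Reals Lra.
From Coquelicot Require Import Coquelicot.
Open Scope R_scope.

(** Write [eps] for [<l', l'>], [p] for the standard basis vector orthogonal to
    the 3-space of the directrix, and [k] for the spherical curvature.  Both
    types of surfaces are [z = f l + g p] with [<l, l> = <p, p> = - eps], and
    [<n, n> = eps] is forced by the signature of the 3-space, so that the two
    types are treated together.

    The tangent vectors [f' l + g' p] and [t = l'], and the normal vectors
    [N = g' l - f' p] and [n], form an orthonormal frame of the ambient space.
    By the Frenet equations of the directrix, [t' = l + eps k n] and
    [n' = - eps k t], and of the meridian, [f'' = m g'] and [g'' = - m f'], the
    derivatives of [N] and of [n] are tangent.  Both fields are therefore
    parallel in the normal bundle, and
      [2 H = eps (g'/f - m) N + (k/f) n]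
    ([mean_curvature_position]) yields at once that [DH = 0] if and only if
    [(g'/f - m)' = 0], [k f' = 0] and [k' = 0]
    ([parallel_mean_curvature_iff]).

    So [k] is constant.  If it is not zero, then [f' = 0], and the meridian is
    a line parallel to the axis: this is (i).  If it is zero, the condition is
    that [g'/f - m] is a constant [2 a], where [a] is not zero because the
    surface is not minimal.  As [(f g')' = f f' (g'/f - m)], this integrates to
    [f g' = c + a f^2] ([constant_bending_equation]), and eliminating [g'] with
    [f'^2 + g'^2 = 1] gives (ii).

    The converse in case (ii) is the delicate point.  The equation determines
    [f g'] up to a sign, which is constant because [f g'] does not vanish;
    differentiating, one finds [g'/f - m] constant where [f'] does not vanish.
    The zeros of [f'] may have interior points, and
    [bending_derive_of_equation] deals with them.

    Flatness in case (i) comes from the Gauss curvature [eps f''/f]; in case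
    (ii) [n' = 0], and the constant vector [n] is normal to the hyperplane. *)

(** * Linear algebra of the neutral space *)

Lemma E42_ext (p q : E42) :
  x1 p = x1 q -> x2 p = x2 q -> x3 p = x3 q -> x4 p = x4 q -> p = q.
Proof.
destruct p as [[[p1 p2] p3] p4], q as [[[q1 q2] q3] q4]; cbn.
intros -> -> -> ->; reflexivity.
Qed.

(** The four coordinates are linear: used as rewrite rules, together with
    [E42_ext], these turn vector identities into real ones. *)
Lemma coord_plus (p q : E42) :
  x1 (plus p q) = x1 p + x1 q /\ x2 (plus p q) = x2 p + x2 q /\
  x3 (plus p q) = x3 p + x3 q /\ x4 (plus p q) = x4 p + x4 q.
Proof. repeat split. Qed.

Lemma coord_scal (a : R) (p : E42) :
  x1 (scal a p) = a * x1 p /\ x2 (scal a p) = a * x2 p /\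
  x3 (scal a p) = a * x3 p /\ x4 (scal a p) = a * x4 p.
Proof. repeat split. Qed.

Lemma coord_minus (p q : E42) :
  x1 (minus p q) = x1 p - x1 q /\ x2 (minus p q) = x2 p - x2 q /\
  x3 (minus p q) = x3 p - x3 q /\ x4 (minus p q) = x4 p - x4 q.
Proof. repeat split. Qed.

Ltac coords :=
  repeat first
    [ rewrite (proj1 (coord_plus _ _))
    | rewrite (proj1 (proj2 (coord_plus _ _)))
    | rewrite (proj1 (proj2 (proj2 (coord_plus _ _))))
    | rewrite (proj2 (proj2 (proj2 (coord_plus _ _))))
    | rewrite (proj1 (coord_scal _ _))
    | rewrite (proj1 (proj2 (coord_scal _ _)))
    | rewrite (proj1 (proj2 (proj2 (coord_scal _ _))))
    | rewrite (proj2 (proj2 (proj2 (coord_scal _ _))))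
    | rewrite (proj1 (coord_minus _ _))
    | rewrite (proj1 (proj2 (coord_minus _ _)))
    | rewrite (proj1 (proj2 (proj2 (coord_minus _ _))))
    | rewrite (proj2 (proj2 (proj2 (coord_minus _ _))))
    | match goal with
      | |- context [x1 (@zero ?G)] => change (x1 (@zero G)) with 0
      | |- context [x2 (@zero ?G)] => change (x2 (@zero G)) with 0
      | |- context [x3 (@zero ?G)] => change (x3 (@zero G)) with 0
      | |- context [x4 (@zero ?G)] => change (x4 (@zero G)) with 0
      end ].

Ltac by_coords := apply E42_ext; coords.

Lemma inner_comm (p q : E42) : inner p q = inner q p.
Proof. unfold inner; ring. Qed.

Lemma inner_plus_l (p q r : E42) : inner (plus p q) r = inner p r + inner q r.
Proof. unfold inner; coords; ring. Qed.

Lemma inner_scal_l (a : R) (p q : E42) : inner (scal a p) q = a * inner p q.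
Proof. unfold inner; coords; ring. Qed.

Lemma inner_minus_l (p q r : E42) : inner (minus p q) r = inner p r - inner q r.
Proof. unfold inner; coords; ring. Qed.

Lemma inner_plus_r (p q r : E42) : inner r (plus p q) = inner r p + inner r q.
Proof. unfold inner; coords; ring. Qed.

Lemma inner_scal_r (a : R) (p q : E42) : inner q (scal a p) = a * inner q p.
Proof. unfold inner; coords; ring. Qed.

Lemma inner_minus_r (p q r : E42) : inner r (minus p q) = inner r p - inner r q.
Proof. unfold inner; coords; ring. Qed.

Lemma inner_zero_l (p : E42) : inner zero p = 0.
Proof. unfold inner; coords; ring. Qed.

Ltac expand_inner :=
  repeat first
    [ rewrite inner_plus_l | rewrite inner_minus_l | rewrite inner_scal_l
    | rewrite inner_plus_r | rewrite inner_minus_r | rewrite inner_scal_r ].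

(** Cramer's rule: each unknown times the determinant is a combination of the
    three equations, with the cofactors as coefficients. *)
Lemma homogeneous_system3 (a1 a2 a3 b1 b2 b3 c1 c2 c3 y1 y2 y3 : R) :
  a1 * (b2 * c3 - b3 * c2) - a2 * (b1 * c3 - b3 * c1)
    + a3 * (b1 * c2 - b2 * c1) <> 0 ->
  a1 * y1 + a2 * y2 + a3 * y3 = 0 ->
  b1 * y1 + b2 * y2 + b3 * y3 = 0 ->
  c1 * y1 + c2 * y2 + c3 * y3 = 0 ->
  y1 = 0 /\ y2 = 0 /\ y3 = 0.
Proof.
set (d := a1 * _ - _ + _); intros Hd Ha Hb Hc.
assert (cancel : forall y, d * y = 0 -> y = 0).
{ intros y Hy; destruct (Rmult_integral _ _ Hy); tauto. }
repeat split; apply cancel.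
- transitivity ((b2 * c3 - b3 * c2) * (a1 * y1 + a2 * y2 + a3 * y3)
    - (a2 * c3 - a3 * c2) * (b1 * y1 + b2 * y2 + b3 * y3)
    + (a2 * b3 - a3 * b2) * (c1 * y1 + c2 * y2 + c3 * y3)).
  + unfold d; ring.
  + rewrite Ha, Hb, Hc; ring.
- transitivity (- (b1 * c3 - b3 * c1) * (a1 * y1 + a2 * y2 + a3 * y3)
    + (a1 * c3 - a3 * c1) * (b1 * y1 + b2 * y2 + b3 * y3)
    - (a1 * b3 - a3 * b1) * (c1 * y1 + c2 * y2 + c3 * y3)).
  + unfold d; ring.
  + rewrite Ha, Hb, Hc; ring.
- transitivity ((b1 * c2 - b2 * c1) * (a1 * y1 + a2 * y2 + a3 * y3)
    - (a1 * c2 - a2 * c1) * (b1 * y1 + b2 * y2 + b3 * y3)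
    + (a1 * b2 - a2 * b1) * (c1 * y1 + c2 * y2 + c3 * y3)).
  + unfold d; ring.
  + rewrite Ha, Hb, Hc; ring.
Qed.

(** The unit vector orthogonal to the 3-space that contains the directrix. *)
Definition pole (ty : meridian_type) : E42 :=
  match ty with M_pp => e4 | Mt_p => e1 end.

Lemma in_span3_orthogonal_pole (ty : meridian_type) (p : E42) :
  in_span3 ty p <-> inner p (pole ty) = 0.
Proof. destruct ty; unfold inner, in_span3; cbn; lra. Qed.

Lemma inner_pole (ty : meridian_type) :
  inner (pole ty) (pole ty) = - speed_sign ty.
Proof. destruct ty; unfold inner; cbn; ring. Qed.

Lemma speed_sign_sqr (ty : meridian_type) : speed_sign ty * speed_sign ty = 1.
Proof. destruct ty; cbn; ring. Qed.

(** The Gram determinant of [l, t, n] is the determinant of the metric of the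
    3-space, [- speed_sign ty], times the square of the determinant [d] of the
    three vectors.  This forces the causal character of [n], and it makes the
    three vectors a basis of the 3-space. *)
Lemma orthonormal_frame_nondegenerate (ty : meridian_type) (l t n : E42) :
  inner l (pole ty) = 0 -> inner t (pole ty) = 0 -> inner n (pole ty) = 0 ->
  inner l l = - speed_sign ty -> inner t t = speed_sign ty ->
  inner l t = 0 -> inner n l = 0 -> inner n t = 0 ->
  inner n n = 1 \/ inner n n = -1 ->
  inner n n = speed_sign ty /\
  forall q, inner q (pole ty) = 0 ->
    inner q l = 0 -> inner q t = 0 -> inner q n = 0 -> q = zero.
Proof.
destruct l as [[[la lb] lc] ld], t as [[[ta tb] tc] td],
  n as [[[na nb] nc] nd].
intros Hl Ht Hn Hll Htt Hlt Hnl Hnt Hnn.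
destruct ty; cbn [speed_sign pole] in *;
  unfold inner, x1, x2, x3, x4, e1, e4 in *; cbn in *.
- assert (ld = 0) by lra; assert (td = 0) by lra; assert (nd = 0) by lra.
  subst ld td nd.
  set (d := la * (tb * nc - tc * nb) - lb * (ta * nc - tc * na)
            + lc * (ta * nb - tb * na)).
  assert (Hd : d * d = na * na + nb * nb - nc * nc - 0 * 0).
  { transitivity (- ((la * la + lb * lb - lc * lc - 0 * 0)
      * ((ta * ta + tb * tb - tc * tc - 0 * 0)
         * (na * na + nb * nb - nc * nc - 0 * 0)
         - (na * ta + nb * tb - nc * tc - 0 * 0) ^ 2)
      - (la * ta + lb * tb - lc * tc - 0 * 0)
      * ((la * ta + lb * tb - lc * tc - 0 * 0)
         * (na * na + nb * nb - nc * nc - 0 * 0)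
         - (na * ta + nb * tb - nc * tc - 0 * 0)
         * (na * la + nb * lb - nc * lc - 0 * 0))
      + (na * la + nb * lb - nc * lc - 0 * 0)
      * ((la * ta + lb * tb - lc * tc - 0 * 0)
         * (na * ta + nb * tb - nc * tc - 0 * 0)
         - (ta * ta + tb * tb - tc * tc - 0 * 0)
         * (na * la + nb * lb - nc * lc - 0 * 0)))).
    - unfold d; ring.
    - rewrite Hll, Htt, Hlt, Hnl, Hnt; ring. }
  split; [nra|].
  intros [[[qa qb] qc] qd] Hq Hql Hqt Hqn; cbn in *.
  destruct (homogeneous_system3 la lb lc ta tb tc na nb nc qa qb (- qc))
    as [Ha [Hb Hc]]; fold d; try lra; try nra.
  by_coords; unfold x1, x2, x3, x4; cbn; lra.
- assert (la = 0) by lra; assert (ta = 0) by lra; assert (na = 0) by lra.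
  subst la ta na.
  set (d := lb * (tc * nd - td * nc) - lc * (tb * nd - td * nb)
            + ld * (tb * nc - tc * nb)).
  assert (Hd : d * d = - (0 * 0 + nb * nb - nc * nc - nd * nd)).
  { transitivity ((0 * 0 + lb * lb - lc * lc - ld * ld)
      * ((0 * 0 + tb * tb - tc * tc - td * td)
         * (0 * 0 + nb * nb - nc * nc - nd * nd)
         - (0 * 0 + nb * tb - nc * tc - nd * td) ^ 2)
      - (0 * 0 + lb * tb - lc * tc - ld * td)
      * ((0 * 0 + lb * tb - lc * tc - ld * td)
         * (0 * 0 + nb * nb - nc * nc - nd * nd)
         - (0 * 0 + nb * tb - nc * tc - nd * td)
         * (0 * 0 + nb * lb - nc * lc - nd * ld))
      + (0 * 0 + nb * lb - nc * lc - nd * ld)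
      * ((0 * 0 + lb * tb - lc * tc - ld * td)
         * (0 * 0 + nb * tb - nc * tc - nd * td)
         - (0 * 0 + tb * tb - tc * tc - td * td)
         * (0 * 0 + nb * lb - nc * lc - nd * ld))).
    - unfold d; ring.
    - rewrite Hll, Htt, Hlt, Hnl, Hnt; ring. }
  split; [nra|].
  intros [[[qa qb] qc] qd] Hq Hql Hqt Hqn; cbn in *.
  destruct (homogeneous_system3 lb lc ld tb tc td nb nc nd qb (- qc) (- qd))
    as [Hb [Hc Hd']]; fold d; try lra; try nra.
  by_coords; unfold x1, x2, x3, x4; cbn; lra.
Qed.

Lemma orthonormal_frame_expansion (ty : meridian_type) (l t n : E42) :
  inner l (pole ty) = 0 -> inner t (pole ty) = 0 -> inner n (pole ty) = 0 ->
  inner l l = - speed_sign ty -> inner t t = speed_sign ty ->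
  inner l t = 0 -> inner n l = 0 -> inner n t = 0 ->
  inner n n = 1 \/ inner n n = -1 ->
  forall w, inner w (pole ty) = 0 ->
    w = plus (scal (- speed_sign ty * inner w l) l)
          (plus (scal (speed_sign ty * inner w t) t)
                (scal (speed_sign ty * inner w n) n)).
Proof.
intros Hl Ht Hn Hll Htt Hlt Hnl Hnt Hnn w Hw.
assert (Heps := speed_sign_sqr ty).
destruct (orthonormal_frame_nondegenerate ty l t n) as [Hnn' nondeg]; auto.
set (w' := plus _ _).
assert (Hdiff : minus w w' = zero).
{ apply nondeg; unfold w'; expand_inner;
    rewrite ?(inner_comm l n), ?(inner_comm t n), ?(inner_comm t l),
      ?Hl, ?Ht, ?Hn, ?Hw, ?Hll, ?Htt, ?Hlt, ?Hnl, ?Hnt, ?Hnn';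
    ring [Heps]. }
transitivity (plus (minus w w') w'); [by_coords; ring|].
rewrite Hdiff; by_coords; ring.
Qed.

(** * Differentiation of vector-valued functions *)

Definition is_vderive (p : R -> E42) (s : R) (q : E42) : Prop :=
  is_derive (fun r => x1 (p r)) s (x1 q) /\
  is_derive (fun r => x2 (p r)) s (x2 q) /\
  is_derive (fun r => x3 (p r)) s (x3 q) /\
  is_derive (fun r => x4 (p r)) s (x4 q).

Ltac per_coordinate := refine (conj _ (conj _ (conj _ _))).

Lemma is_derive_eq (f : R -> R) (s d d' : R) :
  is_derive f s d -> d = d' -> is_derive f s d'.
Proof. intros H <-; exact H. Qed.

Lemma is_derive_Rplus (f g : R -> R) (s df dg : R) :
  is_derive f s df -> is_derive g s dg ->
  is_derive (fun x => f x + g x) s (df + dg).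
Proof. intros Hf Hg; exact (is_derive_plus f g s df dg Hf Hg). Qed.

Lemma is_derive_Rminus (f g : R -> R) (s df dg : R) :
  is_derive f s df -> is_derive g s dg ->
  is_derive (fun x => f x - g x) s (df - dg).
Proof. intros Hf Hg; exact (is_derive_minus f g s df dg Hf Hg). Qed.

Lemma is_derive_Rmult (f g : R -> R) (s df dg : R) :
  is_derive f s df -> is_derive g s dg ->
  is_derive (fun x => f x * g x) s (df * g s + f s * dg).
Proof. intros Hf Hg; exact (is_derive_mult f g s df dg Hf Hg Rmult_comm). Qed.

Lemma is_derive_Rconst (a s : R) : is_derive (fun _ => a) s 0.
Proof. exact (is_derive_const a s). Qed.

Lemma is_vderive_unique (p : R -> E42) (s : R) (q : E42) :
  is_vderive p s q -> vDerive p s = q.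
Proof.
intros (H1 & H2 & H3 & H4); apply E42_ext; apply is_derive_unique; assumption.
Qed.

Lemma is_vderive_eq (p : R -> E42) (s : R) (q q' : E42) :
  is_vderive p s q -> q = q' -> is_vderive p s q'.
Proof. intros H <-; exact H. Qed.

Lemma is_vderive_ext_loc (p p' : R -> E42) (s : R) (q : E42) :
  locally s (fun r => p r = p' r) -> is_vderive p s q -> is_vderive p' s q.
Proof.
intros Hloc (H1 & H2 & H3 & H4); per_coordinate;
  [ refine (is_derive_ext_loc _ _ _ _ _ H1)
  | refine (is_derive_ext_loc _ _ _ _ _ H2)
  | refine (is_derive_ext_loc _ _ _ _ _ H3)
  | refine (is_derive_ext_loc _ _ _ _ _ H4) ];
  revert Hloc; apply filter_imp; intros r ->; reflexivity.
Qed.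

Lemma is_vderive_const (p : E42) (s : R) : is_vderive (fun _ => p) s zero.
Proof. per_coordinate; apply is_derive_Rconst. Qed.

Lemma is_vderive_plus (p q : R -> E42) (s : R) (dp dq : E42) :
  is_vderive p s dp -> is_vderive q s dq ->
  is_vderive (fun r => plus (p r) (q r)) s (plus dp dq).
Proof.
intros (P1 & P2 & P3 & P4) (Q1 & Q2 & Q3 & Q4).
per_coordinate; apply is_derive_Rplus; assumption.
Qed.

Lemma is_vderive_scal (a : R -> R) (p : R -> E42) (s da : R) (dp : E42) :
  is_derive a s da -> is_vderive p s dp ->
  is_vderive (fun r => scal (a r) (p r)) s
    (plus (scal da (p s)) (scal (a s) dp)).
Proof.
intros Ha (P1 & P2 & P3 & P4).
per_coordinate; apply is_derive_Rmult; assumption.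
Qed.

Lemma is_vderive_scal_const (a : R -> R) (p : E42) (s da : R) :
  is_derive a s da -> is_vderive (fun r => scal (a r) p) s (scal da p).
Proof.
intros Ha; eapply is_vderive_eq.
- exact (is_vderive_scal a (fun _ => p) s da zero Ha (is_vderive_const p s)).
- by_coords; ring.
Qed.

Lemma is_vderive_const_scal (a : R) (p : R -> E42) (s : R) (dp : E42) :
  is_vderive p s dp -> is_vderive (fun r => scal a (p r)) s (scal a dp).
Proof.
intros Hp; eapply is_vderive_eq.
- exact (is_vderive_scal (fun _ => a) p s 0 dp (is_derive_Rconst a s) Hp).
- by_coords; ring.
Qed.

Lemma is_derive_inner (p q : R -> E42) (s : R) (dp dq : E42) :
  is_vderive p s dp -> is_vderive q s dq ->
  is_derive (fun r => inner (p r) (q r)) s (inner dp (q s) + inner (p s) dq).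
Proof.
intros (P1 & P2 & P3 & P4) (Q1 & Q2 & Q3 & Q4); unfold inner.
eapply is_derive_eq.
- apply is_derive_Rminus; [apply is_derive_Rminus; [apply is_derive_Rplus|]|];
    apply is_derive_Rmult; eassumption.
- cbv beta; ring.
Qed.

(** * Functions on open intervals *)

Lemma open_interval_locally (I : R -> Prop) (x : R) :
  Defs.open_interval I -> I x -> locally x I.
Proof.
intros (a & b & _ & HI) Hx.
apply HI in Hx; destruct Hx as [Ha Hb].
generalize (filter_and _ _ (open_Rbar_gt a x Ha) (open_Rbar_lt b x Hb)).
apply filter_imp; intros y Hy; apply HI; exact Hy.
Qed.

Lemma open_interval_convex (I : R -> Prop) (x y s : R) :
  Defs.open_interval I -> I x -> I y -> x <= s <= y -> I s.
Proof.
intros (a & b & _ & HI) Hx Hy [Hxs Hsy]; apply HI.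
apply HI in Hx; apply HI in Hy; split.
- exact (Rbar_lt_le_trans a (Finite x) (Finite s) (proj1 Hx) Hxs).
- exact (Rbar_le_lt_trans (Finite s) (Finite y) b Hsy (proj2 Hy)).
Qed.

Lemma open_interval_inhabited (I : R -> Prop) :
  Defs.open_interval I -> exists x, I x.
Proof.
intros (a & b & Hab & HI).
destruct a as [a| |], b as [b| |]; cbn in Hab; try contradiction.
- exists ((a + b) / 2); apply HI; cbn; lra.
- exists (a + 1); apply HI; cbn; split; [lra|exact Logic.I].
- exists (b - 1); apply HI; cbn; split; [exact Logic.I|lra].
- exists 0; apply HI; cbn; auto.
Qed.

Lemma zero_derive_constant (I : R -> Prop) (F : R -> R) (x y : R) :
  Defs.open_interval I -> (forall s, I s -> is_derive F s 0) ->
  I x -> I y -> F x = F y.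
Proof.
intros HI HF Hx Hy.
destruct (Rtotal_order x y) as [Hlt|[->|Hlt]]; [|reflexivity|].
- apply (eq_is_derive (V := R_NormedModule)); [|exact Hlt].
  intros s Hs; apply HF; exact (open_interval_convex I x y s HI Hx Hy Hs).
- symmetry; apply (eq_is_derive (V := R_NormedModule)); [|exact Hlt].
  intros s Hs; apply HF; exact (open_interval_convex I y x s HI Hy Hx Hs).
Qed.

Lemma is_derive_agree (I : R -> Prop) (F G : R -> R) (x dF dG : R) :
  Defs.open_interval I -> I x -> (forall s, I s -> F s = G s) ->
  is_derive F x dF -> is_derive G x dG -> dF = dG.
Proof.
intros HI Hx Heq HF HG.
rewrite <- (is_derive_unique _ _ _ HF), <- (is_derive_unique _ _ _ HG).
apply Derive_ext_loc; generalize (open_interval_locally I x HI Hx).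
apply filter_imp; exact Heq.
Qed.

Lemma constant_is_derive (I : R -> Prop) (F : R -> R) (a x : R) :
  Defs.open_interval I -> (forall s, I s -> F s = a) -> I x -> is_derive F x 0.
Proof.
intros HI HF Hx; refine (is_derive_ext_loc _ _ _ _ _ (is_derive_Rconst a x)).
generalize (open_interval_locally I x HI Hx); apply filter_imp.
intros s Hs; symmetry; exact (HF s Hs).
Qed.

(** The ratio [Q / P] takes the values 1 and -1, and its derivative vanishes
    because [P P' = Q Q']. *)
Lemma equal_squares_global_sign (I : R -> Prop) (P Q dP dQ : R -> R) :
  Defs.open_interval I ->
  (forall x, I x -> is_derive P x (dP x)) ->
  (forall x, I x -> is_derive Q x (dQ x)) ->
  (forall x, I x -> P x <> 0) -> (forall x, I x -> P x ^ 2 = Q x ^ 2) ->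
  exists s, is_sign s /\ forall x, I x -> Q x = s * P x.
Proof.
intros HI HP HQ HP0 Hsq.
assert (HdPQ : forall x, I x -> P x * dP x = Q x * dQ x).
{ intros x Hx.
  assert (H : 2 * (P x * dP x) = 2 * (Q x * dQ x)); [|lra].
  apply (is_derive_agree I (fun y => P y * P y) (fun y => Q y * Q y) x _ _ HI Hx).
  - intros y Hy; generalize (Hsq y Hy); simpl; lra.
  - eapply is_derive_eq; [apply is_derive_Rmult; apply HP; exact Hx|ring].
  - eapply is_derive_eq; [apply is_derive_Rmult; apply HQ; exact Hx|ring]. }
assert (Hratio : forall x, I x -> is_derive (fun y => Q y / P y) x 0).
{ intros x Hx; eapply is_derive_eq.
  - exact (is_derive_div Q P x (dQ x) (dP x) (HQ x Hx) (HP x Hx) (HP0 x Hx)).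
  - assert (HPx := HP0 x Hx); assert (HQx : Q x <> 0).
    { intros E; generalize (Hsq x Hx); rewrite E; intros H.
      apply (pow_nonzero _ 2) in HPx; lra. }
    apply (Rmult_eq_reg_l (P x ^ 2 * Q x));
      [|apply Rmult_integral_contrapositive; split; auto with real].
    field_simplify; auto.
    replace (dQ x) with (P x * dP x / Q x) by (rewrite HdPQ; auto; field; auto).
    field_simplify; auto.
    rewrite (Hsq x Hx); ring. }
destruct (open_interval_inhabited I HI) as [x0 Hx0].
exists (Q x0 / P x0); split.
- assert (H := Hsq x0 Hx0); assert (H0 := HP0 x0 Hx0).
  destruct (Rmult_integral (Q x0 - P x0) (Q x0 + P x0)) as [E|E]; [lra| |].
  + left; replace (Q x0) with (P x0) by lra; field; exact H0.
  + right; replace (Q x0) with (- P x0) by lra; field; exact H0.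
- intros x Hx.
  rewrite (zero_derive_constant I (fun y => Q y / P y) x0 x HI Hratio Hx0 Hx).
  field; exact (HP0 x Hx).
Qed.

(** * The directrix and its moving frame *)

(** Functions that can be differentiated [k] times on [I], the derivatives
    being given by witnesses: closure under products and compositions then
    does not require [I] to be open. *)
Fixpoint times_derivable (k : nat) (I : R -> Prop) (f : R -> R) : Prop :=
  match k with
  | O => True
  | S k => exists f', (forall x, I x -> is_derive f x (f' x)) /\
                      times_derivable k I f'
  end.

Lemma times_derivable_pred (k : nat) (I : R -> Prop) (f : R -> R) :
  times_derivable (S k) I f -> times_derivable k I f.
Proof.
revert f; induction k as [|k IH]; intros f Hf; [exact Logic.I|].
destruct Hf as (f' & Hf & Hf'); exists f'; split; [exact Hf|exact (IH f' Hf')].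
Qed.

Lemma times_derivable_const (k : nat) (I : R -> Prop) (a : R) :
  times_derivable k I (fun _ => a).
Proof.
revert a; induction k as [|k IH]; intros a; [exact Logic.I|].
exists (fun _ => 0); split; [intros x _; apply is_derive_Rconst|apply IH].
Qed.

Lemma times_derivable_plus (k : nat) (I : R -> Prop) (f g : R -> R) :
  times_derivable k I f -> times_derivable k I g ->
  times_derivable k I (fun x => f x + g x).
Proof.
revert f g; induction k as [|k IH]; intros f g Hf Hg; [exact Logic.I|].
destruct Hf as (f' & Hf & Hf'), Hg as (g' & Hg & Hg').
exists (fun x => f' x + g' x); split; [|exact (IH _ _ Hf' Hg')].
intros x Hx; apply is_derive_Rplus; auto.
Qed.

Lemma times_derivable_mult (k : nat) (I : R -> Prop) (f g : R -> R) :
  times_derivable k I f -> times_derivable k I g ->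
  times_derivable k I (fun x => f x * g x).
Proof.
revert f g; induction k as [|k IH]; intros f g Hf Hg; [exact Logic.I|].
assert (Hf0 := times_derivable_pred k I f Hf).
assert (Hg0 := times_derivable_pred k I g Hg).
destruct Hf as (f' & Hf & Hf'), Hg as (g' & Hg & Hg').
exists (fun x => f' x * g x + f x * g' x); split.
- intros x Hx; apply is_derive_Rmult; auto.
- apply times_derivable_plus; apply IH; assumption.
Qed.

(** Covers the pairs (sin, cos), with [e = -1], and (sinh, cosh), with
    [e = 1]; the two compositions have to be treated together. *)
Lemma times_derivable_comp_pair (S C : R -> R) (e : R)
    (k : nat) (I : R -> Prop) (w : R -> R) :
  (forall x, is_derive S x (C x)) -> (forall x, is_derive C x (e * S x)) ->
  times_derivable k I w ->
  times_derivable k I (fun x => S (w x)) /\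
  times_derivable k I (fun x => C (w x)).
Proof.
intros HS HC; revert w; induction k as [|k IH]; intros w Hw; [split; exact Logic.I|].
destruct (IH w (times_derivable_pred k I w Hw)) as [IHS IHC].
destruct Hw as (w' & Hw & Hw'); split.
- exists (fun x => w' x * C (w x)); split; [|apply times_derivable_mult; assumption].
  intros x Hx; exact (is_derive_comp S w x _ _ (HS (w x)) (Hw x Hx)).
- exists (fun x => w' x * (e * S (w x))); split.
  + intros x Hx; exact (is_derive_comp C w x _ _ (HC (w x)) (Hw x Hx)).
  + apply times_derivable_mult; [assumption|].
    apply times_derivable_mult; [apply times_derivable_const|assumption].
Qed.

Lemma smooth_on_is_derive (I : R -> Prop) (f : R -> R) (x : R) :
  smooth_on I f -> I x -> is_derive f x (Derive f x).
Proof. intros Hf Hx; apply Derive_correct; exact (Hf 1%nat x Hx). Qed.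

Lemma smooth_on_Derive (I : R -> Prop) (f : R -> R) :
  smooth_on I f -> smooth_on I (Derive f).
Proof.
intros Hf [|k] x Hx; [exact Logic.I|].
refine (ex_derive_ext _ _ _ _ (Hf (S (S k)) x Hx)).
intros y; rewrite <- (Nat.add_1_r k); symmetry; exact (Derive_n_comp f k 1 y).
Qed.

Lemma smooth_on_times_derivable (k : nat) (I : R -> Prop) (f : R -> R) :
  smooth_on I f -> times_derivable k I f.
Proof.
revert f; induction k as [|k IH]; intros f Hf; [exact Logic.I|].
exists (Derive f); split; [|exact (IH _ (smooth_on_Derive I f Hf))].
intros x Hx; exact (smooth_on_is_derive I f x Hf Hx).
Qed.

Fixpoint times_vderivable (k : nat) (J : R -> Prop) (p : R -> E42) : Prop :=
  match k with
  | O => True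
  | S k => exists p', (forall v, J v -> is_vderive p v (p' v)) /\
                      times_vderivable k J p'
  end.

Lemma times_vderivable_coords (k : nat) (J : R -> Prop) (p : R -> E42) :
  times_derivable k J (fun v => x1 (p v)) ->
  times_derivable k J (fun v => x2 (p v)) ->
  times_derivable k J (fun v => x3 (p v)) ->
  times_derivable k J (fun v => x4 (p v)) -> times_vderivable k J p.
Proof.
revert p; induction k as [|k IH]; intros p; [intros; exact Logic.I|].
intros (a & Ha & Ha') (b & Hb & Hb') (c & Hc & Hc') (d & Hd & Hd').
exists (fun v => (a v, b v, c v, d v)); split.
- intros v Hv; per_coordinate; auto.
- apply IH; assumption.
Qed.

Lemma directrix_times_vderivable (ty : meridian_type) (k : nat)
    (J : R -> Prop) (w1 w2 : R -> R) :
  smooth_on J w1 -> smooth_on J w2 -> times_vderivable k J (directrix ty w1 w2).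
Proof.
intros H1 H2.
apply (smooth_on_times_derivable k) in H1.
apply (smooth_on_times_derivable k) in H2.
destruct (times_derivable_comp_pair sinh cosh 1 k J w1) as [Hsh Hch]; [| |assumption|].
{ intros x; apply is_derive_Reals, derivable_pt_lim_sinh. }
{ intros x; rewrite Rmult_1_l; apply is_derive_Reals, derivable_pt_lim_cosh. }
destruct (times_derivable_comp_pair sin cos (-1) k J w2) as [Hs Hc]; [| |assumption|].
{ intros x; apply is_derive_Reals, derivable_pt_lim_sin. }
{ intros x; replace (-1 * sin x) with (- sin x) by ring.
  apply is_derive_Reals, derivable_pt_lim_cos. }
assert (H0 := times_derivable_const k J 0).
assert (Hsc := times_derivable_mult k J _ _ Hsh Hc).
assert (Hss := times_derivable_mult k J _ _ Hsh Hs).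
apply times_vderivable_coords; destruct ty; assumption.
Qed.

Lemma inner_directrix_pole (ty : meridian_type) (w1 w2 : R -> R) (v : R) :
  inner (directrix ty w1 w2 v) (pole ty) = 0.
Proof. destruct ty; unfold inner; cbn; ring. Qed.

Lemma inner_directrix (ty : meridian_type) (w1 w2 : R -> R) (v : R) :
  inner (directrix ty w1 w2 v) (directrix ty w1 w2 v) = - speed_sign ty.
Proof.
assert (Hh : cosh (w1 v) ^ 2 - sinh (w1 v) ^ 2 = 1).
{ unfold cosh, sinh; rewrite <- (Rinv_r (exp (w1 v))) by
    (apply Rgt_not_eq, exp_pos); rewrite exp_Ropp; field.
  apply Rgt_not_eq, exp_pos. }
assert (Ht := sin2_cos2 (w2 v)); unfold Rsqr in Ht.
destruct ty; unfold inner; cbn -[sinh cosh]; nra.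
Qed.

(** The orthonormal frame [l, t, n] of the 3-space orthogonal to the pole,
    with its Frenet equations, [k] being the spherical curvature. *)
Record moving_frame (ty : meridian_type) (J : R -> Prop)
    (l t n : R -> E42) (k : R -> R) : Prop := {
  mf_l_pole : forall v, J v -> inner (l v) (pole ty) = 0;
  mf_t_pole : forall v, J v -> inner (t v) (pole ty) = 0;
  mf_n_pole : forall v, J v -> inner (n v) (pole ty) = 0;
  mf_ll : forall v, J v -> inner (l v) (l v) = - speed_sign ty;
  mf_tt : forall v, J v -> inner (t v) (t v) = speed_sign ty;
  mf_nn : forall v, J v -> inner (n v) (n v) = speed_sign ty;
  mf_lt : forall v, J v -> inner (l v) (t v) = 0;
  mf_nl : forall v, J v -> inner (n v) (l v) = 0;
  mf_nt : forall v, J v -> inner (n v) (t v) = 0;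
  mf_dl : forall v, J v -> is_vderive l v (t v);
  mf_dt : forall v, J v ->
    is_vderive t v (plus (l v) (scal (speed_sign ty * k v) (n v)));
  mf_dn : forall v, J v -> is_vderive n v (scal (- speed_sign ty * k v) (t v));
  mf_dk : forall v, J v -> ex_derive k v
}.

Lemma inner_constant_derive (J : R -> Prop) (p q : R -> E42) (c v : R)
    (dp dq : E42) :
  Defs.open_interval J -> J v ->
  (forall s, J s -> inner (p s) (q s) = c) ->
  is_vderive p v dp -> is_vderive q v dq ->
  inner dp (q v) + inner (p v) dq = 0.
Proof.
intros HJ Hv Hc Hp Hq.
exact (is_derive_agree J _ _ v _ _ HJ Hv Hc
  (is_derive_inner p q v dp dq Hp Hq) (is_derive_Rconst c v)).
Qed.

(** Differentiating the orthonormality relations gives the products of [t']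
    and [n'] with the frame, and the expansion in the frame does the rest. *)
Lemma directrix_moving_frame (ty : meridian_type) (I J : R -> Prop)
    (f g w1 w2 : R -> R) (n : R -> E42) :
  meridian_surface ty I J f g w1 w2 ->
  frame_normal ty J (directrix ty w1 w2) n ->
  exists t, moving_frame ty J (directrix ty w1 w2) t n
              (spherical_curvature (directrix ty w1 w2) n).
Proof.
intros ms [Hn Hframe]; set (l := directrix ty w1 w2) in *.
assert (HJ := ms_interval_J _ _ _ _ _ _ _ ms).
destruct (directrix_times_vderivable ty 3 J w1 w2) as
  (t & Hl & t' & Ht & t'' & Ht' & _);
  [apply (ms_smooth_w1 _ _ _ _ _ _ _ ms)|apply (ms_smooth_w2 _ _ _ _ _ _ _ ms)|].
fold l in Hl; exists t.
assert (Hvl : forall v, J v -> vDerive l v = t v).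
{ intros v Hv; apply is_vderive_unique, Hl, Hv. }
assert (Hvt : forall v, J v -> vDerive (vDerive l) v = t' v).
{ intros v Hv; apply is_vderive_unique.
  refine (is_vderive_ext_loc _ _ _ _ _ (Ht v Hv)).
  generalize (open_interval_locally J v HJ Hv); apply filter_imp.
  intros s Hs; symmetry; exact (Hvl s Hs). }
assert (Hdn : forall v, J v -> is_vderive n v (vDerive n v)).
{ intros v Hv; destruct Hn as (H1 & H2 & H3 & H4); per_coordinate;
    [ exact (smooth_on_is_derive J _ v H1 Hv)
    | exact (smooth_on_is_derive J _ v H2 Hv)
    | exact (smooth_on_is_derive J _ v H3 Hv)
    | exact (smooth_on_is_derive J _ v H4 Hv) ]. }
set (k := spherical_curvature l n).
assert (Hk : forall v, J v -> k v = inner (t' v) (n v)).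
{ intros v Hv; unfold k, spherical_curvature; rewrite (Hvt v Hv); reflexivity. }
assert (Hpole := fun v => is_vderive_const (pole ty) v).
assert (lp : forall v, J v -> inner (l v) (pole ty) = 0).
{ intros v _; apply inner_directrix_pole. }
assert (ll : forall v, J v -> inner (l v) (l v) = - speed_sign ty).
{ intros v _; apply inner_directrix. }
assert (tp : forall v, J v -> inner (t v) (pole ty) = 0).
{ intros v Hv.
  generalize (inner_constant_derive J _ _ _ v _ _ HJ Hv lp (Hl v Hv) (Hpole v)).
  rewrite (inner_comm _ zero), inner_zero_l; lra. }
assert (tp' : forall v, J v -> inner (t' v) (pole ty) = 0).
{ intros v Hv.
  generalize (inner_constant_derive J _ _ _ v _ _ HJ Hv tp (Ht v Hv) (Hpole v)).
  rewrite (inner_comm _ zero), inner_zero_l; lra. }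
assert (lt : forall v, J v -> inner (l v) (t v) = 0).
{ intros v Hv.
  generalize (inner_constant_derive J _ _ _ v _ _ HJ Hv ll (Hl v Hv) (Hl v Hv)).
  rewrite (inner_comm (t v)); lra. }
assert (tt : forall v, J v -> inner (t v) (t v) = speed_sign ty).
{ intros v Hv; generalize (ms_unit_directrix _ _ _ _ _ _ _ ms v Hv).
  fold l; rewrite (Hvl v Hv); auto. }
assert (np : forall v, J v -> inner (n v) (pole ty) = 0).
{ intros v Hv; apply in_span3_orthogonal_pole, (Hframe v Hv). }
assert (nl : forall v, J v -> inner (n v) (l v) = 0).
{ intros v Hv; apply (Hframe v Hv). }
assert (nt : forall v, J v -> inner (n v) (t v) = 0).
{ intros v Hv; rewrite <- (Hvl v Hv); apply (Hframe v Hv). }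
assert (nn1 : forall v, J v -> inner (n v) (n v) = 1 \/ inner (n v) (n v) = -1).
{ intros v Hv; apply (Hframe v Hv). }
assert (nn : forall v, J v -> inner (n v) (n v) = speed_sign ty).
{ intros v Hv; apply (orthonormal_frame_nondegenerate ty (l v) (t v) (n v)); auto. }
assert (np' : forall v, J v -> inner (vDerive n v) (pole ty) = 0).
{ intros v Hv.
  generalize (inner_constant_derive J _ _ _ v _ _ HJ Hv np (Hdn v Hv) (Hpole v)).
  rewrite (inner_comm _ zero), inner_zero_l; lra. }
assert (expand := fun v (Hv : J v) => orthonormal_frame_expansion ty
  (l v) (t v) (n v) (lp v Hv) (tp v Hv) (np v Hv) (ll v Hv) (tt v Hv) (lt v Hv)
  (nl v Hv) (nt v Hv) (nn1 v Hv)).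
assert (Heps := speed_sign_sqr ty).
constructor; auto.
- intros v Hv; apply (is_vderive_eq _ _ _ _ (Ht v Hv)).
  rewrite (expand v Hv (t' v) (tp' v Hv)).
  assert (Hl' := inner_constant_derive J _ _ _ v _ _ HJ Hv lt (Hl v Hv) (Ht v Hv)).
  assert (Ht2 := inner_constant_derive J _ _ _ v _ _ HJ Hv tt (Ht v Hv) (Ht v Hv)).
  rewrite (inner_comm (l v)), (tt v Hv) in Hl'; rewrite (inner_comm (t v)) in Ht2.
  replace (inner (t' v) (l v)) with (- speed_sign ty) by lra.
  replace (inner (t' v) (t v)) with 0 by lra.
  rewrite <- (Hk v Hv); by_coords; ring [Heps].
- intros v Hv; apply (is_vderive_eq _ _ _ _ (Hdn v Hv)).
  rewrite (expand v Hv (vDerive n v) (np' v Hv)).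
  assert (Hl' := inner_constant_derive J _ _ _ v _ _ HJ Hv nl (Hdn v Hv) (Hl v Hv)).
  assert (Ht2 := inner_constant_derive J _ _ _ v _ _ HJ Hv nt (Hdn v Hv) (Ht v Hv)).
  assert (Hn2 := inner_constant_derive J _ _ _ v _ _ HJ Hv nn (Hdn v Hv) (Hdn v Hv)).
  rewrite (nt v Hv) in Hl'; rewrite (inner_comm (n v)), <- (Hk v Hv) in Ht2.
  rewrite (inner_comm (n v)) in Hn2.
  replace (inner (vDerive n v) (l v)) with 0 by lra.
  replace (inner (vDerive n v) (t v)) with (- k v) by lra.
  replace (inner (vDerive n v) (n v)) with 0 by lra.
  by_coords; ring.
- intros v Hv; apply (ex_derive_ext_loc (fun s => inner (t' s) (n s))).
  + generalize (open_interval_locally J v HJ Hv); apply filter_imp.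
    intros s Hs; symmetry; exact (Hk s Hs).
  + eexists; exact (is_derive_inner _ _ v _ _ (Ht' v Hv) (Hdn v Hv)).
Qed.

(** * Second fundamental form and mean curvature of a meridian surface *)

Section MeridianSurface.

Context (ty : meridian_type) (I J : R -> Prop) (f g w1 w2 : R -> R)
  (l t n : R -> E42) (k : R -> R).
Hypothesis ms : meridian_surface ty I J f g w1 w2.
Hypothesis mf : moving_frame ty J l t n k.

Let eps := speed_sign ty.
Let z := position ty f g l.

Definition meridian_tangent (u v : R) : E42 :=
  plus (scal (Derive f u) (l v)) (scal (Derive g u) (pole ty)).

(** Together with [n] it spans the normal planes of the surface. *)
Definition meridian_normal (u v : R) : E42 :=
  plus (scal (Derive g u) (l v)) (scal (- Derive f u) (pole ty)).

Definition meridian_curvature (u : R) : R :=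
  Derive (Derive f) u * Derive g u - Derive (Derive g) u * Derive f u.

(** Up to sign, twice the component of the mean curvature vector along
    [meridian_normal]. *)
Definition meridian_bending (u : R) : R :=
  Derive g u / f u - meridian_curvature u.

(** Every vector field below is given by its coordinates in this orthonormal
    frame: differentiation in [u] and [v] acts on them by the Frenet equations,
    and the tangential and normal projections keep the first two, respectively
    the last two. *)
Definition adapted (a b c d u v : R) : E42 :=
  plus (plus (scal a (meridian_tangent u v)) (scal b (t v)))
       (plus (scal c (meridian_normal u v)) (scal d (n v))).

Lemma eps_sqr : eps * eps = 1.
Proof. exact (speed_sign_sqr ty). Qed.

Lemma eps_neq0 : eps <> 0.
Proof. generalize eps_sqr; nra. Qed.

Lemma near_I (u : R) : I u -> locally u I.
Proof. apply open_interval_locally, (ms_interval_I _ _ _ _ _ _ _ ms). Qed.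

Lemma near_J (v : R) : J v -> locally v J.
Proof. apply open_interval_locally, (ms_interval_J _ _ _ _ _ _ _ ms). Qed.

Lemma is_derive_f (u : R) : I u -> is_derive f u (Derive f u).
Proof. apply smooth_on_is_derive, (ms_smooth_f _ _ _ _ _ _ _ ms). Qed.

Lemma is_derive_g (u : R) : I u -> is_derive g u (Derive g u).
Proof. apply smooth_on_is_derive, (ms_smooth_g _ _ _ _ _ _ _ ms). Qed.

Lemma is_derive_df (u : R) :
  I u -> is_derive (Derive f) u (Derive (Derive f) u).
Proof.
apply smooth_on_is_derive, smooth_on_Derive, (ms_smooth_f _ _ _ _ _ _ _ ms).
Qed.

Lemma is_derive_dg (u : R) :
  I u -> is_derive (Derive g) u (Derive (Derive g) u).
Proof.
apply smooth_on_is_derive, smooth_on_Derive, (ms_smooth_g _ _ _ _ _ _ _ ms).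
Qed.

Lemma ex_derive_bending (u : R) : I u -> ex_derive meridian_bending u.
Proof.
intros Hu; unfold meridian_bending, meridian_curvature.
assert (Hf3 : ex_derive (Derive (Derive f)) u).
{ eexists; apply (smooth_on_is_derive I); [|exact Hu].
  do 2 apply smooth_on_Derive; exact (ms_smooth_f _ _ _ _ _ _ _ ms). }
assert (Hg3 : ex_derive (Derive (Derive g)) u).
{ eexists; apply (smooth_on_is_derive I); [|exact Hu].
  do 2 apply smooth_on_Derive; exact (ms_smooth_g _ _ _ _ _ _ _ ms). }
assert (Hf := is_derive_f u Hu); assert (Hf1 := is_derive_df u Hu).
assert (Hg1 := is_derive_dg u Hu).
assert (Hf0 := ms_f_neq0 _ _ _ _ _ _ _ ms u Hu).
apply (ex_derive_minus (V := R_NormedModule)).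
- apply ex_derive_div; [eexists; exact Hg1|eexists; exact Hf|exact Hf0].
- apply (ex_derive_minus (V := R_NormedModule));
    apply ex_derive_mult; auto; eexists; eassumption.
Qed.

Lemma meridian_unit_derive (u : R) :
  I u ->
  Derive f u * Derive (Derive f) u + Derive g u * Derive (Derive g) u = 0.
Proof.
intros Hu.
enough (2 * (Derive f u * Derive (Derive f) u
             + Derive g u * Derive (Derive g) u) = 0) by lra.
apply (is_derive_agree I
  (fun s => Derive f s * Derive f s + Derive g s * Derive g s) (fun _ => 1) u
  _ _ (ms_interval_I _ _ _ _ _ _ _ ms) Hu).
- intros s Hs; generalize (ms_unit_meridian _ _ _ _ _ _ _ ms s Hs); simpl; lra.
- eapply is_derive_eq; [apply is_derive_Rplus; apply is_derive_Rmult;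
    first [apply is_derive_df|apply is_derive_dg]; exact Hu|ring].
- apply is_derive_Rconst.
Qed.

(** The Frenet equations of the meridian. *)
Lemma meridian_frenet (u : R) :
  I u -> Derive (Derive f) u = meridian_curvature u * Derive g u /\
         Derive (Derive g) u = - meridian_curvature u * Derive f u.
Proof.
intros Hu; assert (H0 := meridian_unit_derive u Hu).
assert (H1 := ms_unit_meridian _ _ _ _ _ _ _ ms u Hu).
unfold meridian_curvature; split.
- transitivity (Derive (Derive f) u * (Derive f u ^ 2 + Derive g u ^ 2)
    - Derive f u * (Derive f u * Derive (Derive f) u
                    + Derive g u * Derive (Derive g) u));
    [rewrite H0, H1; ring|ring].
- transitivity (Derive (Derive g) u * (Derive f u ^ 2 + Derive g u ^ 2)
    - Derive g u * (Derive f u * Derive (Derive f) u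
                    + Derive g u * Derive (Derive g) u));
    [rewrite H0, H1; ring|ring].
Qed.

Lemma inner_adapted (a b c d a' b' c' d' u v : R) :
  I u -> J v ->
  inner (adapted a b c d u v) (adapted a' b' c' d' u v) =
  eps * (b * b' + d * d' - a * a' - c * c').
Proof.
intros Hu Hv; assert (H1 := ms_unit_meridian _ _ _ _ _ _ _ ms u Hu).
transitivity (eps * (b * b' + d * d')
  - eps * (a * a' + c * c') * (Derive f u ^ 2 + Derive g u ^ 2));
  [|rewrite H1; ring].
unfold adapted, meridian_tangent, meridian_normal; expand_inner.
rewrite ?(inner_comm (pole ty) (l v)), ?(inner_comm (pole ty) (t v)),
  ?(inner_comm (pole ty) (n v)), ?(inner_comm (l v) (n v)),
  ?(inner_comm (t v) (n v)), ?(inner_comm (t v) (l v)), inner_pole,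
  ?(mf_l_pole _ _ _ _ _ _ mf v Hv), ?(mf_t_pole _ _ _ _ _ _ mf v Hv),
  ?(mf_n_pole _ _ _ _ _ _ mf v Hv), ?(mf_ll _ _ _ _ _ _ mf v Hv),
  ?(mf_tt _ _ _ _ _ _ mf v Hv), ?(mf_nn _ _ _ _ _ _ mf v Hv),
  ?(mf_lt _ _ _ _ _ _ mf v Hv), ?(mf_nl _ _ _ _ _ _ mf v Hv),
  ?(mf_nt _ _ _ _ _ _ mf v Hv).
fold eps; ring.
Qed.

Lemma position_decomp (u v : R) :
  z u v = plus (scal (f u) (l v)) (scal (g u) (pole ty)).
Proof.
unfold z, position, pole; destruct ty; [reflexivity|by_coords; ring].
Qed.

Lemma Du_position (u v : R) : I u -> Du z u v = meridian_tangent u v.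
Proof.
intros Hu; apply is_vderive_unique.
apply (is_vderive_ext_loc
  (fun s => plus (scal (f s) (l v)) (scal (g s) (pole ty)))).
- apply filter_forall; intros s; symmetry; apply position_decomp.
- apply is_vderive_plus; apply is_vderive_scal_const;
    [apply is_derive_f|apply is_derive_g]; exact Hu.
Qed.

Lemma Dv_position (u v : R) : J v -> Dv z u v = scal (f u) (t v).
Proof.
intros Hv; apply is_vderive_unique.
apply (is_vderive_ext_loc
  (fun s => plus (scal (f u) (l s)) (scal (g u) (pole ty)))).
- apply filter_forall; intros s; symmetry; apply position_decomp.
- eapply is_vderive_eq; [apply is_vderive_plus|].
  + apply is_vderive_const_scal, (mf_dl _ _ _ _ _ _ mf v Hv).
  + apply is_vderive_const.
  + by_coords; ring.
Qed.

(** The adapted frame moves by the Frenet equations of the two curves. *)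
Lemma adapted_derive_u (a b c d : R -> R) (da db dc dd u v : R) :
  I u -> is_derive a u da -> is_derive b u db ->
  is_derive c u dc -> is_derive d u dd ->
  is_vderive (fun s => adapted (a s) (b s) (c s) (d s) s v) u
    (adapted (da - c u * meridian_curvature u) db
             (dc + a u * meridian_curvature u) dd u v).
Proof.
intros Hu Ha Hb Hc Hd; destruct (meridian_frenet u Hu) as [Ef Eg].
eapply is_vderive_eq.
- apply is_vderive_plus; apply is_vderive_plus.
  + apply is_vderive_scal; [exact Ha|].
    apply is_vderive_plus; apply is_vderive_scal_const;
      [apply is_derive_df|apply is_derive_dg]; exact Hu.
  + apply is_vderive_scal_const; exact Hb.
  + apply is_vderive_scal; [exact Hc|].
    apply is_vderive_plus; apply is_vderive_scal_const;
      [apply is_derive_dg; exact Hu|].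
    exact (is_derive_opp (V := R_NormedModule) _ _ _ (is_derive_df u Hu)).
  + apply is_vderive_scal_const; exact Hd.
- cbv beta; change (opp (Derive (Derive f) u)) with (- Derive (Derive f) u).
  rewrite Ef, Eg; unfold adapted, meridian_tangent, meridian_normal.
  by_coords; ring.
Qed.

Lemma adapted_derive_v (a b c d : R -> R) (da db dc dd u v : R) :
  I u -> J v -> is_derive a v da -> is_derive b v db ->
  is_derive c v dc -> is_derive d v dd ->
  is_vderive (fun s => adapted (a s) (b s) (c s) (d s) u s) v
    (adapted (da + b v * Derive f u)
             (db + a v * Derive f u + c v * Derive g u - d v * eps * k v)
             (dc + b v * Derive g u) (dd + b v * eps * k v) u v).
Proof.
intros Hu Hv Ha Hb Hc Hd.
assert (H1 := ms_unit_meridian _ _ _ _ _ _ _ ms u Hu).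
assert (Hl := mf_dl _ _ _ _ _ _ mf v Hv).
eapply is_vderive_eq.
- apply is_vderive_plus; apply is_vderive_plus; apply is_vderive_scal;
    [exact Ha| |exact Hb|exact (mf_dt _ _ _ _ _ _ mf v Hv)
    |exact Hc| |exact Hd|exact (mf_dn _ _ _ _ _ _ mf v Hv)];
    (apply is_vderive_plus;
     [apply is_vderive_const_scal; exact Hl|apply is_vderive_const]).
- cbv beta; fold eps; unfold adapted, meridian_tangent, meridian_normal.
  (* the [l]-component of [t'] is split along the meridian frame *)
  replace (scal (b v) (plus (l v) (scal (eps * k v) (n v)))) with
    (plus (scal (b v * (Derive f u ^ 2 + Derive g u ^ 2)) (l v))
          (scal (b v * eps * k v) (n v)))
    by (rewrite H1; by_coords; ring).
  by_coords; ring.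
Qed.

Lemma Du_adapted (X : R -> R -> E42) (a b c d : R -> R)
    (da db dc dd u v : R) :
  I u -> (forall s, I s -> X s v = adapted (a s) (b s) (c s) (d s) s v) ->
  is_derive a u da -> is_derive b u db ->
  is_derive c u dc -> is_derive d u dd ->
  Du X u v = adapted (da - c u * meridian_curvature u) db
                     (dc + a u * meridian_curvature u) dd u v.
Proof.
intros Hu HX Ha Hb Hc Hd; apply is_vderive_unique.
apply (is_vderive_ext_loc (fun s => adapted (a s) (b s) (c s) (d s) s v)).
- generalize (near_I u Hu); apply filter_imp; intros s Hs; symmetry; auto.
- apply adapted_derive_u; assumption.
Qed.

Lemma Dv_adapted (X : R -> R -> E42) (a b c d : R -> R)
    (da db dc dd u v : R) :
  I u -> J v ->
  (forall s, J s -> X u s = adapted (a s) (b s) (c s) (d s) u s) ->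
  is_derive a v da -> is_derive b v db ->
  is_derive c v dc -> is_derive d v dd ->
  Dv X u v =
    adapted (da + b v * Derive f u)
            (db + a v * Derive f u + c v * Derive g u - d v * eps * k v)
            (dc + b v * Derive g u) (dd + b v * eps * k v) u v.
Proof.
intros Hu Hv HX Ha Hb Hc Hd; apply is_vderive_unique.
apply (is_vderive_ext_loc (fun s => adapted (a s) (b s) (c s) (d s) u s)).
- generalize (near_J v Hv); apply filter_imp; intros s Hs; symmetry; auto.
- apply adapted_derive_v; assumption.
Qed.

Lemma Du_position_adapted (u v : R) :
  I u -> Du z u v = adapted 1 0 0 0 u v.
Proof.
intros Hu; rewrite (Du_position u v Hu); unfold adapted; by_coords; ring.
Qed.

Lemma Dv_position_adapted (u v : R) :
  J v -> Dv z u v = adapted 0 (f u) 0 0 u v.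
Proof.
intros Hv; rewrite (Dv_position u v Hv); unfold adapted; by_coords; ring.
Qed.

Lemma fffE_position (u v : R) : I u -> J v -> fffE z u v = - eps.
Proof.
intros Hu Hv; unfold fffE; rewrite (Du_position_adapted u v Hu).
rewrite inner_adapted by assumption; ring.
Qed.

Lemma fffF_position (u v : R) : I u -> J v -> fffF z u v = 0.
Proof.
intros Hu Hv; unfold fffF.
rewrite (Du_position_adapted u v Hu), (Dv_position_adapted u v Hv).
rewrite inner_adapted by assumption; ring.
Qed.

Lemma fffG_position (u v : R) : I u -> J v -> fffG z u v = eps * f u ^ 2.
Proof.
intros Hu Hv; unfold fffG; rewrite (Dv_position_adapted u v Hv).
rewrite inner_adapted by assumption; ring.
Qed.

Lemma fffdet_position (u v : R) : I u -> J v -> fffdet z u v = - f u ^ 2.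
Proof.
intros Hu Hv; unfold fffdet.
rewrite fffE_position, fffF_position, fffG_position by assumption.
ring [eps_sqr].
Qed.

Lemma tangent_part_adapted (a b c d u v : R) :
  I u -> J v ->
  tangent_part z u v (adapted a b c d u v) = adapted a b 0 0 u v.
Proof.
intros Hu Hv; assert (Hf := ms_f_neq0 _ _ _ _ _ _ _ ms u Hu).
unfold tangent_part.
rewrite fffE_position, fffF_position, fffG_position, fffdet_position,
  (Du_position_adapted u v Hu), (Dv_position_adapted u v Hv), !inner_adapted
  by assumption.
replace (_ / - f u ^ 2) with a by
  (field_simplify_eq; [ring [eps_sqr]|exact Hf]).
replace (_ / - f u ^ 2) with (b / f u) by
  (field_simplify_eq; [ring [eps_sqr]|exact Hf]).
unfold adapted; by_coords; field; exact Hf.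
Qed.

Lemma normal_part_adapted (a b c d u v : R) :
  I u -> J v ->
  normal_part z u v (adapted a b c d u v) = adapted 0 0 c d u v.
Proof.
intros Hu Hv; unfold normal_part; rewrite tangent_part_adapted by assumption.
unfold adapted; by_coords; ring.
Qed.

Lemma Duu_position (u v : R) :
  I u -> J v -> Du (Du z) u v = adapted 0 0 (meridian_curvature u) 0 u v.
Proof.
intros Hu Hv.
rewrite (Du_adapted (Du z) (fun _ => 1) (fun _ => 0) (fun _ => 0) (fun _ => 0)
  0 0 0 0 u v Hu); try apply is_derive_Rconst.
- f_equal; ring.
- intros s Hs; apply Du_position_adapted; assumption.
Qed.

Lemma Duv_position (u v : R) :
  I u -> J v -> Du (Dv z) u v = adapted 0 (Derive f u) 0 0 u v.
Proof.
intros Hu Hv.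
rewrite (Du_adapted (Dv z) (fun _ => 0) f (fun _ => 0) (fun _ => 0)
  0 (Derive f u) 0 0 u v Hu); try apply is_derive_Rconst.
- f_equal; ring.
- intros s Hs; apply Dv_position_adapted; assumption.
- apply is_derive_f; exact Hu.
Qed.

Lemma Dvv_position (u v : R) :
  I u -> J v ->
  Dv (Dv z) u v =
    adapted (f u * Derive f u) 0 (f u * Derive g u) (f u * eps * k v) u v.
Proof.
intros Hu Hv.
rewrite (Dv_adapted (Dv z) (fun _ => 0) (fun _ => f u) (fun _ => 0)
  (fun _ => 0) 0 0 0 0 u v Hu Hv); try apply is_derive_Rconst.
- f_equal; ring.
- intros s Hs; apply Dv_position_adapted; assumption.
Qed.

Lemma mean_curvature_position (u v : R) :
  I u -> J v ->
  mean_curvature z u v =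
    adapted 0 0 (eps * meridian_bending u / 2) (k v / f u / 2) u v.
Proof.
intros Hu Hv; assert (Hf := ms_f_neq0 _ _ _ _ _ _ _ ms u Hu).
unfold mean_curvature, trace_h, huu, huv, hvv.
rewrite Duu_position, Duv_position, Dvv_position, !normal_part_adapted,
  fffE_position, fffF_position, fffG_position, fffdet_position by assumption.
replace (k v / f u / 2) with (eps * eps * k v / f u / 2)
  by (rewrite eps_sqr; field; exact Hf).
unfold adapted, meridian_bending; by_coords; field; exact Hf.
Qed.

Lemma normal_D_u_mean_curvature (u v : R) :
  I u -> J v ->
  normal_D_u z (mean_curvature z) u v =
    adapted 0 0 (eps * Derive meridian_bending u / 2)
                (- (k v * Derive f u) / (2 * f u ^ 2)) u v.
Proof.
intros Hu Hv; assert (Hf := ms_f_neq0 _ _ _ _ _ _ _ ms u Hu).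
unfold normal_D_u.
rewrite (Du_adapted (mean_curvature z) (fun _ => 0) (fun _ => 0)
  (fun s => eps * meridian_bending s / 2) (fun s => k v / f s / 2) 0 0
  (eps * Derive meridian_bending u / 2)
  (- (k v * Derive f u) / (2 * f u ^ 2)) u v Hu).
- rewrite normal_part_adapted by assumption; f_equal; ring.
- intros s Hs; apply mean_curvature_position; assumption.
- apply is_derive_Rconst.
- apply is_derive_Rconst.
- auto_derive; [exact (ex_derive_bending u Hu)|].
  change (fun x => meridian_bending x) with meridian_bending; field.
- auto_derive.
  + split; [exists (Derive f u); apply is_derive_f; exact Hu|auto].
  + change (fun x => f x) with f; field; exact Hf.
Qed.

Lemma normal_D_v_mean_curvature (u v : R) :
  I u -> J v ->
  normal_D_v z (mean_curvature z) u v =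
    adapted 0 0 0 (Derive k v / f u / 2) u v.
Proof.
intros Hu Hv; assert (Hf := ms_f_neq0 _ _ _ _ _ _ _ ms u Hu).
unfold normal_D_v.
rewrite (Dv_adapted (mean_curvature z) (fun _ => 0) (fun _ => 0)
  (fun _ => eps * meridian_bending u / 2) (fun s => k s / f u / 2) 0 0
  0 (Derive k v / f u / 2) u v Hu Hv); try apply is_derive_Rconst.
- rewrite normal_part_adapted by assumption; f_equal; ring.
- intros s Hs; apply mean_curvature_position; assumption.
- auto_derive; [exact (mf_dk _ _ _ _ _ _ mf v Hv)|].
  change (fun x => k x) with k; field; exact Hf.
Qed.

Lemma adapted_normal_eq0 (c d u v : R) :
  I u -> J v -> (adapted 0 0 c d u v = zero <-> c = 0 /\ d = 0).
Proof.
intros Hu Hv; split.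
- intros H; generalize eps_neq0; intros He.
  assert (Hc := inner_adapted 0 0 c d 0 0 1 0 u v Hu Hv).
  assert (Hd := inner_adapted 0 0 c d 0 0 0 1 u v Hu Hv).
  rewrite H, inner_zero_l in Hc, Hd.
  split; apply (Rmult_eq_reg_l eps); auto; lra.
- intros [-> ->]; unfold adapted; by_coords; ring.
Qed.

Lemma minimal_iff :
  minimal I J z <->
  forall u v, I u -> J v -> meridian_bending u = 0 /\ k v = 0.
Proof.
generalize eps_neq0; intros He; split; intros H u v Hu Hv;
  assert (Hf := ms_f_neq0 _ _ _ _ _ _ _ ms u Hu).
- assert (H0 := H u v Hu Hv); rewrite mean_curvature_position in H0 by assumption.
  apply adapted_normal_eq0 in H0; [|assumption..]; destruct H0 as [H1 H2]; split.
  + apply (Rmult_eq_reg_l eps); [lra|exact He].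
  + apply (Rmult_eq_reg_r (/ f u)); [lra|apply Rinv_neq_0_compat, Hf].
- rewrite mean_curvature_position by assumption.
  apply adapted_normal_eq0; [assumption..|].
  destruct (H u v Hu Hv) as [-> ->]; split; field; exact Hf.
Qed.

(** Both normal frame fields, [meridian_normal] and [n], are parallel, so [DH]
    is read off from the derivatives of the two coordinates of [H]. *)
Lemma parallel_mean_curvature_iff :
  parallel_mean_curvature I J z <->
  forall u v, I u -> J v ->
    Derive meridian_bending u = 0 /\ k v * Derive f u = 0 /\ Derive k v = 0.
Proof.
generalize eps_neq0; intros He; split; intros H u v Hu Hv;
  assert (Hf := ms_f_neq0 _ _ _ _ _ _ _ ms u Hu);
  assert (Hf' := Rinv_neq_0_compat _ Hf).
- destruct (H u v Hu Hv) as [Hu0 Hv0].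
  rewrite normal_D_u_mean_curvature in Hu0 by assumption.
  rewrite normal_D_v_mean_curvature in Hv0 by assumption.
  apply adapted_normal_eq0 in Hu0, Hv0; [|assumption..].
  destruct Hu0 as [H1 H2], Hv0 as [_ H3]; repeat split.
  + apply (Rmult_eq_reg_l eps); [lra|exact He].
  + replace (k v * Derive f u) with
      (- 2 * f u ^ 2 * (- (k v * Derive f u) / (2 * f u ^ 2)))
      by (field; exact Hf); rewrite H2; ring.
  + apply (Rmult_eq_reg_r (/ f u)); [lra|exact Hf'].
- destruct (H u v Hu Hv) as (H1 & H2 & H3).
  rewrite normal_D_u_mean_curvature, normal_D_v_mean_curvature by assumption.
  rewrite !adapted_normal_eq0, H1, H2, H3 by assumption.
  repeat split; field; exact Hf.
Qed.

Lemma inner_mean_curvature (u v : R) :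
  I u -> J v ->
  inner (mean_curvature z u v) (mean_curvature z u v) =
    eps * ((k v / f u) ^ 2 - meridian_bending u ^ 2) / 4.
Proof.
intros Hu Hv; assert (Hf := ms_f_neq0 _ _ _ _ _ _ _ ms u Hu).
rewrite mean_curvature_position, inner_adapted by assumption.
replace (0 * 0 + _ - 0 * 0 - _) with
  ((k v / f u) ^ 2 / 4 - eps * eps * meridian_bending u ^ 2 / 4)
  by (field; exact Hf).
rewrite eps_sqr; field; exact Hf.
Qed.

(** The classical formula for the Gauss curvature of a metric
    [-eps (du^2 - f^2 dv^2)]. *)
Lemma gauss_curvature_position (u v : R) :
  I u -> J v -> gauss_curvature z u v = eps * Derive (Derive f) u / f u.
Proof.
intros Hu Hv; assert (Hf := ms_f_neq0 _ _ _ _ _ _ _ ms u Hu).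
unfold gauss_curvature, nabla_u at 1, nabla_v at 2.
rewrite (Du_adapted (nabla_v z (Dv z)) (fun s => f s * Derive f s) (fun _ => 0)
  (fun _ => 0) (fun _ => 0)
  (Derive f u * Derive f u + f u * Derive (Derive f) u) 0 0 0 u v Hu);
  try apply is_derive_Rconst.
2: { intros s Hs; unfold nabla_v.
     rewrite Dvv_position, tangent_part_adapted by assumption; reflexivity. }
2: { apply is_derive_Rmult; [apply is_derive_f|apply is_derive_df]; exact Hu. }
rewrite (Dv_adapted (nabla_u z (Dv z)) (fun _ => 0) (fun _ => Derive f u)
  (fun _ => 0) (fun _ => 0) 0 0 0 0 u v Hu Hv); try apply is_derive_Rconst.
2: { intros s Hs; unfold nabla_u.
     rewrite Duv_position, tangent_part_adapted by assumption; reflexivity. }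
rewrite !tangent_part_adapted, (Du_position_adapted u v Hu), inner_minus_l,
  !inner_adapted, fffdet_position by assumption.
field; exact Hf.
Qed.

(** When the spherical curvature vanishes, [n] is constant; it is orthogonal
    to the directrix and to the pole. *)
Lemma zero_curvature_hyperplane :
  (forall v, J v -> k v = 0) -> lies_in_hyperplane I J z.
Proof.
intros Hk; assert (HJ := ms_interval_J _ _ _ _ _ _ _ ms).
destruct (open_interval_inhabited J HJ) as [v0 Hv0].
assert (Hn : forall v, J v -> n v0 = n v).
{ assert (Hdn : forall v, J v -> is_vderive n v zero).
  { intros v Hv; apply (is_vderive_eq _ _ _ _ (mf_dn _ _ _ _ _ _ mf v Hv)).
    rewrite (Hk v Hv); by_coords; ring. }
  intros v Hv; apply E42_ext.
  - apply (zero_derive_constant J (fun s => x1 (n s))); auto; apply Hdn.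
  - apply (zero_derive_constant J (fun s => x2 (n s))); auto; apply Hdn.
  - apply (zero_derive_constant J (fun s => x3 (n s))); auto; apply Hdn.
  - apply (zero_derive_constant J (fun s => x4 (n s))); auto; apply Hdn. }
exists (n v0), 0; split.
- intros E; assert (H := mf_nn _ _ _ _ _ _ mf v0 Hv0).
  rewrite E, inner_zero_l in H; exact (eps_neq0 (eq_sym H)).
- intros u v Hu Hv; rewrite position_decomp; expand_inner.
  rewrite (Hn v Hv), (mf_nl _ _ _ _ _ _ mf v Hv), (mf_n_pole _ _ _ _ _ _ mf v Hv).
  ring.
Qed.

End MeridianSurface.

(** * The meridian equation *)

(** The function [f g'] has derivative [f f' bending]; for a constant bending
    [2 a] this is the derivative of [a f^2]. *)
Lemma flux_is_derive (ty : meridian_type) (I J : R -> Prop)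
    (f g w1 w2 : R -> R) (u : R) :
  meridian_surface ty I J f g w1 w2 -> I u ->
  is_derive (fun s => f s * Derive g s) u
    (f u * Derive f u * meridian_bending f g u).
Proof.
intros ms Hu; assert (Hf := ms_f_neq0 _ _ _ _ _ _ _ ms u Hu).
eapply is_derive_eq.
- apply is_derive_Rmult; [apply (is_derive_f _ _ _ _ _ _ _ ms u Hu)
    |apply (is_derive_dg _ _ _ _ _ _ _ ms u Hu)].
- rewrite (proj2 (meridian_frenet _ _ _ _ _ _ _ ms u Hu)).
  unfold meridian_bending; field; exact Hf.
Qed.

Lemma constant_bending_equation (ty : meridian_type) (I J : R -> Prop)
    (f g w1 w2 : R -> R) :
  meridian_surface ty I J f g w1 w2 ->
  (forall u, I u -> Derive (meridian_bending f g) u = 0) ->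
  exists a c, forall u, I u ->
    meridian_bending f g u = 2 * a /\ f u * Derive g u = c + a * f u ^ 2.
Proof.
intros ms H; assert (HI := ms_interval_I _ _ _ _ _ _ _ ms).
destruct (open_interval_inhabited I HI) as [u0 Hu0].
set (a := meridian_bending f g u0 / 2).
assert (Hb : forall u, I u -> meridian_bending f g u = 2 * a).
{ intros u Hu; unfold a.
  rewrite (zero_derive_constant I (meridian_bending f g) u u0 HI); auto; [field|].
  intros s Hs; rewrite <- (H s Hs); apply Derive_correct.
  exact (ex_derive_bending _ _ _ _ _ _ _ ms s Hs). }
exists a, (f u0 * Derive g u0 - a * (f u0 * f u0)); intros u Hu.
split; [exact (Hb u Hu)|].
enough (f u * Derive g u - a * (f u * f u) =
        f u0 * Derive g u0 - a * (f u0 * f u0)) by (simpl; lra).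
apply (zero_derive_constant I
  (fun s => f s * Derive g s - a * (f s * f s)) u u0 HI); auto.
intros s Hs; assert (Hf := is_derive_f _ _ _ _ _ _ _ ms s Hs).
eapply is_derive_eq.
- apply is_derive_Rminus; [exact (flux_is_derive _ _ _ _ _ _ _ s ms Hs)|].
  apply is_derive_Rmult; [apply is_derive_Rconst|].
  apply is_derive_Rmult; exact Hf.
- cbv beta; rewrite (Hb s Hs); ring.
Qed.

(** Where [f'] vanishes identically the meridian is a line parallel to the
    axis, along which the bending is [g' / f] with [g'] and [f] constant. *)
Lemma bending_derive_of_constant_radius (ty : meridian_type) (I J : R -> Prop)
    (f g w1 w2 : R -> R) (u : R) :
  meridian_surface ty I J f g w1 w2 -> I u ->
  locally u (fun s => Derive f s = 0) -> Derive (meridian_bending f g) u = 0.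
Proof.
intros ms Hu Hloc; assert (Hf := ms_f_neq0 _ _ _ _ _ _ _ ms u Hu).
assert (Hdf : Derive f u = 0) by exact (locally_singleton _ _ Hloc).
assert (Hm : locally u (fun s => Derive g s / f s = meridian_bending f g s)).
{ generalize (locally_locally u _ Hloc); apply filter_imp; intros s Hs.
  unfold meridian_bending, meridian_curvature.
  replace (Derive (Derive f) s) with 0.
  - rewrite (locally_singleton _ _ Hs); ring.
  - rewrite (Derive_ext_loc (Derive f) (fun _ => 0) s Hs), Derive_const.
    reflexivity. }
apply is_derive_unique, (is_derive_ext_loc _ _ _ _ Hm).
eapply is_derive_eq.
- exact (is_derive_div _ _ u _ _ (is_derive_dg _ _ _ _ _ _ _ ms u Hu)
    (is_derive_f _ _ _ _ _ _ _ ms u Hu) Hf).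
- rewrite (proj2 (meridian_frenet _ _ _ _ _ _ _ ms u Hu)), Hdf; field; exact Hf.
Qed.

(** Differentiating the equation gives only [f' B = 0], where [B] is the
    bending minus a constant, and [f'] may vanish on part of the interval.
    But [B] can fail to vanish only where [f'] is locally zero, where
    [B' = 0]; hence [(B^2)' = 2 B B' = 0] throughout. *)
Lemma bending_derive_of_equation (ty : meridian_type) (I J : R -> Prop)
    (f g w1 w2 : R -> R) (a c : R) :
  meridian_surface ty I J f g w1 w2 ->
  (forall u, I u -> (f u * Derive g u) ^ 2 = (c + a * f u ^ 2) ^ 2) ->
  forall u, I u -> Derive (meridian_bending f g) u = 0.
Proof.
intros ms Hsq; assert (HI := ms_interval_I _ _ _ _ _ _ _ ms).
assert (Hdf := is_derive_f _ _ _ _ _ _ _ ms).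
assert (HdQ : forall u, I u ->
  is_derive (fun u => c + a * f u ^ 2) u (a * (2 * f u * Derive f u))).
{ intros u Hu; eapply is_derive_eq.
  - apply is_derive_Rplus; [apply is_derive_Rconst|].
    apply is_derive_Rmult; [apply is_derive_Rconst|].
    apply (is_derive_pow f 2); exact (Hdf u Hu).
  - simpl; ring. }
destruct (equal_squares_global_sign I (fun u => f u * Derive g u)
  (fun u => c + a * f u ^ 2) (fun u => f u * Derive f u * meridian_bending f g u)
  (fun u => a * (2 * f u * Derive f u))) as (s & Hs & Heq); auto.
{ intros u Hu; exact (flux_is_derive _ _ _ _ _ _ _ u ms Hu). }
{ intros u Hu; apply Rmult_integral_contrapositive; split;
    [exact (ms_f_neq0 _ _ _ _ _ _ _ ms u Hu)
    |exact (ms_dg_neq0 _ _ _ _ _ _ _ ms u Hu)]. }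
(* [s^-1 = s], so [2 a s] is the value predicted where [f'] does not vanish *)
set (B := fun u => meridian_bending f g u - 2 * a * s).
assert (HB : forall u, I u -> Derive f u * B u = 0).
{ intros u Hu; apply (Rmult_eq_reg_l (s * f u)).
  2: { apply Rmult_integral_contrapositive; split;
         [destruct Hs; lra|exact (ms_f_neq0 _ _ _ _ _ _ _ ms u Hu)]. }
  assert (H : a * (2 * f u * Derive f u) =
    0 * (f u * Derive g u) + s * (f u * Derive f u * meridian_bending f g u)).
  { apply (is_derive_agree I (fun u => c + a * f u ^ 2)
      (fun u => s * (f u * Derive g u)) u _ _ HI Hu Heq).
    - exact (HdQ u Hu).
    - exact (is_derive_Rmult (fun _ => s) (fun x => f x * Derive g x) u 0 _
        (is_derive_Rconst s u) (flux_is_derive _ _ _ _ _ _ _ u ms Hu)). }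
  assert (Hss : s * s = 1) by (destruct Hs as [-> | ->]; ring).
  unfold B; transitivity (s * (f u * Derive f u * meridian_bending f g u)
    - s * s * (a * (2 * f u * Derive f u))); [ring|].
  rewrite Hss, H; ring. }
assert (HdB : forall u, I u -> is_derive B u (Derive (meridian_bending f g) u)).
{ intros u Hu; eapply is_derive_eq.
  - apply is_derive_Rminus; [|apply is_derive_Rconst].
    apply Derive_correct; exact (ex_derive_bending _ _ _ _ _ _ _ ms u Hu).
  - ring. }
assert (HBB : forall u, I u -> B u <> 0 -> Derive (meridian_bending f g) u = 0).
{ intros u Hu Hne.
  apply (bending_derive_of_constant_radius _ _ _ _ _ _ _ u ms Hu).
  assert (Hloc : locally u (fun x => B x <> 0)).
  { assert (Hc : continuous B u).
    { apply (ex_derive_continuous B u); eexists; exact (HdB u Hu). }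
    apply (Hc (fun y => y <> 0)); exact (open_neq 0 (B u) Hne). }
  generalize (filter_and _ _ (open_interval_locally I u HI Hu) Hloc).
  apply filter_imp; intros x [Hx HBx].
  destruct (Rmult_integral _ _ (HB x Hx)); [assumption|contradiction]. }
intros u Hu; destruct (Req_dec (B u) 0) as [HBu|HBu]; [|exact (HBB u Hu HBu)].
rewrite <- (is_derive_unique B u _ (HdB u Hu)).
apply is_derive_unique, (constant_is_derive I B 0 u HI); [|exact Hu].
intros x Hx; apply Rsqr_0_uniq; unfold Rsqr.
transitivity (B u * B u); [|rewrite HBu; ring].
apply (zero_derive_constant I (fun x => B x * B x) x u HI); auto.
intros y Hy; eapply is_derive_eq; [apply is_derive_Rmult; exact (HdB y Hy)|].
destruct (Req_dec (B y) 0) as [E|E]; [rewrite E; ring|].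
rewrite (HBB y Hy E); ring.
Qed.

Lemma phi_sqr (a c s t : R) :
  t <> 0 -> 0 <= radicand a c s t -> phi a c s t ^ 2 = radicand a c s t / t ^ 2.
Proof.
intros Ht Hr; unfold phi; rewrite Rpow_mult_distr, pow2_sqrt by exact Hr.
field; exact Ht.
Qed.

Lemma case_ii_equation (ty : meridian_type) (I J : R -> Prop)
    (f g w1 w2 : R -> R) (a c s : R) (u : R) :
  meridian_surface ty I J f g w1 w2 -> I u ->
  0 <= radicand a c s (f u) ->
  Derive f u ^ 2 = phi a c s (f u) ^ 2 ->
  (f u * Derive g u) ^ 2 = (c + s * a * f u ^ 2) ^ 2.
Proof.
intros ms Hu Hr Hphi; assert (Hf := ms_f_neq0 _ _ _ _ _ _ _ ms u Hu).
rewrite phi_sqr in Hphi by assumption.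
assert (H1 := ms_unit_meridian _ _ _ _ _ _ _ ms u Hu).
replace ((f u * Derive g u) ^ 2) with (f u ^ 2 - f u ^ 2 * Derive f u ^ 2)
  by (replace (Derive f u ^ 2) with (1 - Derive g u ^ 2) by lra; ring).
rewrite Hphi; unfold radicand; field; exact Hf.
Qed.

(** The radicand is [(f f')^2], so it is nonnegative along the meridian. *)
Lemma equation_case_ii (ty : meridian_type) (I J : R -> Prop)
    (f g w1 w2 : R -> R) (a c : R) (u : R) :
  meridian_surface ty I J f g w1 w2 -> I u ->
  f u * Derive g u = c + a * f u ^ 2 ->
  0 <= radicand a c 1 (f u) /\ Derive f u ^ 2 = phi a c 1 (f u) ^ 2.
Proof.
intros ms Hu E; assert (Hf := ms_f_neq0 _ _ _ _ _ _ _ ms u Hu).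
assert (H1 := ms_unit_meridian _ _ _ _ _ _ _ ms u Hu).
assert (Hr : radicand a c 1 (f u) = (f u * Derive f u) ^ 2).
{ unfold radicand; rewrite Rmult_1_l, <- E.
  replace ((f u * Derive f u) ^ 2) with (f u ^ 2 * Derive f u ^ 2) by ring.
  replace (Derive f u ^ 2) with (1 - Derive g u ^ 2) by lra; ring. }
assert (Hr0 : 0 <= radicand a c 1 (f u)) by (rewrite Hr; apply pow2_ge_0).
split; [exact Hr0|].
rewrite phi_sqr, Hr by assumption; field; exact Hf.
Qed.

(** [sqrt (1 - f'^2)] is [|g'|], and [g'] keeps its sign on the interval. *)
Lemma dg_global_sqrt (ty : meridian_type) (I J : R -> Prop)
    (f g w1 w2 : R -> R) :
  meridian_surface ty I J f g w1 w2 ->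
  (forall u, I u -> Derive g u = sqrt (1 - Derive f u ^ 2)) \/
  (forall u, I u -> Derive g u = - sqrt (1 - Derive f u ^ 2)).
Proof.
intros ms.
assert (Habs : forall u, I u -> sqrt (1 - Derive f u ^ 2) = Rabs (Derive g u)).
{ intros u Hu; rewrite <- sqrt_Rsqr_abs; f_equal; unfold Rsqr.
  generalize (ms_unit_meridian _ _ _ _ _ _ _ ms u Hu); simpl; lra. }
destruct (equal_squares_global_sign I (Derive g) (fun u => Rabs (Derive g u))
  (Derive (Derive g))
  (fun u => sign (Derive g u) * Derive (Derive g) u)) as (s & [-> | ->] & Hs).
- exact (ms_interval_I _ _ _ _ _ _ _ ms).
- exact (is_derive_dg _ _ _ _ _ _ _ ms).
- intros u Hu; apply is_derive_Rabs;
    [exact (is_derive_dg _ _ _ _ _ _ _ ms u Hu)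
    |exact (ms_dg_neq0 _ _ _ _ _ _ _ ms u Hu)].
- exact (ms_dg_neq0 _ _ _ _ _ _ _ ms).
- intros u _; rewrite pow2_abs; reflexivity.
- left; intros u Hu; rewrite (Habs u Hu), (Hs u Hu); ring.
- right; intros u Hu; rewrite (Habs u Hu), (Hs u Hu); ring.
Qed.

Lemma straight_meridian (ty : meridian_type) (I J : R -> Prop)
    (f g w1 w2 : R -> R) :
  meridian_surface ty I J f g w1 w2 ->
  (forall u, I u -> Derive f u = 0) ->
  exists a b s, a <> 0 /\ is_sign s /\
    forall u, I u -> f u = a /\ g u = s * u + b.
Proof.
intros ms Hdf; assert (HI := ms_interval_I _ _ _ _ _ _ _ ms).
destruct (open_interval_inhabited I HI) as [u0 Hu0].
destruct (equal_squares_global_sign I (fun _ => 1) (Derive g) (fun _ => 0)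
  (Derive (Derive g))) as (s & Hs & Hg); auto.
{ intros; apply is_derive_Rconst. }
{ exact (is_derive_dg _ _ _ _ _ _ _ ms). }
{ intros u Hu; generalize (ms_unit_meridian _ _ _ _ _ _ _ ms u Hu).
  rewrite (Hdf u Hu); simpl; lra. }
exists (f u0), (g u0 - s * u0), s; split; [|split; [exact Hs|]].
{ exact (ms_f_neq0 _ _ _ _ _ _ _ ms u0 Hu0). }
intros u Hu; split.
- apply (zero_derive_constant I f u u0 HI); auto.
  intros x Hx; rewrite <- (Hdf x Hx).
  exact (is_derive_f _ _ _ _ _ _ _ ms x Hx).
- enough (g u - s * u = g u0 - s * u0) by lra.
  apply (zero_derive_constant I (fun x => g x - s * x) u u0 HI); auto.
  intros x Hx; eapply is_derive_eq.
  + apply is_derive_Rminus; [exact (is_derive_g _ _ _ _ _ _ _ ms x Hx)|].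
    apply is_derive_Rmult; [apply is_derive_Rconst|].
    exact (is_derive_id (K := R_AbsRing) x).
  + rewrite (Hg x Hx); change one with 1; ring.
Qed.

Lemma straight_meridian_derivatives (I : R -> Prop) (f g : R -> R)
    (a b s : R) :
  Defs.open_interval I ->
  (forall u, I u -> f u = a /\ g u = s * u + b) ->
  forall u, I u ->
    Derive f u = 0 /\ Derive (Derive f) u = 0 /\ meridian_bending f g u = s / a.
Proof.
intros HI H.
assert (Hf : forall u, I u -> Derive f u = 0).
{ intros u Hu; apply is_derive_unique, (constant_is_derive I f a u HI); auto.
  intros x Hx; apply H; exact Hx. }
intros u Hu.
assert (Hff : Derive (Derive f) u = 0).
{ apply is_derive_unique, (constant_is_derive I _ 0 u HI); auto. }
split; [exact (Hf u Hu)|split; [exact Hff|]].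
assert (Hg : Derive g u = s).
{ rewrite (Derive_ext_loc g (fun x => s * x + b)).
  - apply is_derive_unique; auto_derive; [exact Logic.I|ring].
  - generalize (open_interval_locally I u HI Hu); apply filter_imp.
    intros x Hx; apply H; exact Hx. }
unfold meridian_bending, meridian_curvature.
rewrite Hff, (Hf u Hu), Hg, (proj1 (H u Hu)); ring.
Qed.

(** * Surfaces with parallel mean curvature vector field *)

Theorem theorem4p3 (ty : meridian_type) (I J : R -> Prop)
    (f g w1 w2 : R -> R) (n : R -> E42)
    (l := directrix ty w1 w2) (z := position ty f g l)
    (kappa := spherical_curvature l n) :
  meridian_surface ty I J f g w1 w2 ->
  frame_normal ty J l n ->
  ~ minimal I J z ->
  (parallel_mean_curvature I J z <->
     case_i I J f g kappa \/ case_ii I J f g kappa) /\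
  (case_i I J f g kappa -> flat I J z /\ CMC I J z) /\
  (case_ii I J f g kappa -> lies_in_hyperplane I J z).
Proof.
intros ms Hframe Hmin.
assert (HI := ms_interval_I _ _ _ _ _ _ _ ms).
assert (HJ := ms_interval_J _ _ _ _ _ _ _ ms).
destruct (open_interval_inhabited I HI) as [u0 Hu0].
destruct (open_interval_inhabited J HJ) as [v0 Hv0].
destruct (directrix_moving_frame ty I J f g w1 w2 n ms Hframe) as [t mf].
fold l in mf; fold kappa in mf.
assert (Hpar := parallel_mean_curvature_iff _ _ _ _ _ _ _ _ _ _ _ ms mf).
assert (Hmin' := minimal_iff _ _ _ _ _ _ _ _ _ _ _ ms mf).
change (position ty f g l) with z in Hpar, Hmin'.
assert (Hconst : forall c, (forall v, J v -> kappa v = c) ->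
  forall v, J v -> Derive kappa v = 0).
{ intros c Hc v Hv.
  apply is_derive_unique, (constant_is_derive J kappa c v HJ); assumption. }
split; [split|split].
- intros HP; assert (H := proj1 Hpar HP).
  assert (Hk : forall v, J v -> kappa v = kappa v0).
  { intros v Hv; apply (zero_derive_constant J kappa v v0 HJ); auto.
    intros x Hx; rewrite <- (proj2 (proj2 (H u0 x Hu0 Hx))).
    apply Derive_correct, (mf_dk _ _ _ _ _ _ mf x Hx). }
  destruct (Req_dec (kappa v0) 0) as [Hk0|Hk0].
  + right; split; [intros v Hv; rewrite (Hk v Hv); exact Hk0|].
    split; [|exact (dg_global_sqrt _ _ _ _ _ _ _ ms)].
    destruct (constant_bending_equation _ _ _ _ _ _ _ ms) as (a & c & Hac).
    { intros u Hu; exact (proj1 (H u v0 Hu Hv0)). }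
    exists a, c, 1; split; [|split; [left; reflexivity|]].
    * intros ->; apply Hmin; apply (proj2 Hmin'); intros u v Hu Hv; split.
      -- rewrite (proj1 (Hac u Hu)); ring.
      -- rewrite (Hk v Hv); exact Hk0.
    * intros u Hu.
      exact (equation_case_ii _ _ _ _ _ _ _ a c u ms Hu (proj2 (Hac u Hu))).
  + left; split; [exists (kappa v0); exact Hk|].
    apply (straight_meridian _ _ _ _ _ _ _ ms); intros u Hu.
    destruct (Rmult_integral _ _ (proj1 (proj2 (H u v0 Hu Hv0))));
      [contradiction|assumption].
- intros [[[c Hc] (a & b & s & Ha & Hs & Hfg)]|[Hk [(a & c & s & Ha & Hs & H) _]]];
    apply (proj2 Hpar); intros u v Hu Hv.
  + assert (Hd := straight_meridian_derivatives I f g a b s HI Hfg).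
    split; [|split; [|exact (Hconst c Hc v Hv)]].
    * apply is_derive_unique, (constant_is_derive I _ (s / a) u HI); [|exact Hu].
      intros x Hx; apply (Hd x Hx).
    * rewrite (proj1 (Hd u Hu)); ring.
  + split; [|split; [rewrite (Hk v Hv); ring|exact (Hconst 0 Hk v Hv)]].
    refine (bending_derive_of_equation _ _ _ _ _ _ _ (s * a) c ms _ u Hu).
    intros x Hx; destruct (H x Hx) as [Hr Hphi].
    exact (case_ii_equation _ _ _ _ _ _ _ a c s x ms Hx Hr Hphi).
- intros [[c Hc] (a & b & s & Ha & Hs & Hfg)].
  assert (Hd := straight_meridian_derivatives I f g a b s HI Hfg).
  split.
  + intros u v Hu Hv; unfold z.
    rewrite (gauss_curvature_position _ _ _ _ _ _ _ _ _ _ _ ms mf u v Hu Hv).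
    rewrite (proj1 (proj2 (Hd u Hu))); unfold Rdiv; ring.
  + exists (speed_sign ty * ((c / a) ^ 2 - (s / a) ^ 2) / 4).
    intros u v Hu Hv; unfold z.
    rewrite (inner_mean_curvature _ _ _ _ _ _ _ _ _ _ _ ms mf u v Hu Hv).
    rewrite (proj2 (proj2 (Hd u Hu))), (Hc v Hv), (proj1 (Hfg u Hu)).
    reflexivity.
- intros [Hk _]; exact (zero_curvature_hyperplane _ _ _ _ _ _ _ _ _ _ _ ms mf Hk).
Qed.
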